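(* Let $R,J:\mathbb{R}^n\to]-\infty,+\infty]$ be proper, convex and lower semi-continuous with $\mathrm{ri}(\mathrm{dom}(R))\cap\mathrm{ri}(\mathrm{dom}(J))\neq\emptyset$ and $\mathrm{Argmin}(R+J)\neq\emptyset$. Let $\gamma>0$, $z_0\in\mathbb{R}^n$, $x_0=\mathrm{prox}_{\gamma J}(z_0)$, and let $\{u_k\},\{z_k\},\{x_k\}$ be generated by the Douglas--Rachford iteration $$u_{k+1}=\mathrm{prox}_{\gamma R}(2x_k-z_k),\qquad z_{k+1}=z_k+u_{k+1}-x_k,\qquad x_{k+1}=\mathrm{prox}_{\gamma J}(z_{k+1}),$$ so that $z_k\to z^\star$ (a fixed point of the iteration) and $x_k,u_k\to x^\star=\mathrm{prox}_{\gamma J}(z^\star)\in\mathrm{Argmin}(R+J)$. Suppose that $R$ is locally $C^2$ around $x^\star$, that $J$ is partly smooth at $x^\star$ relative to a $C^2$-manifold $\mathcal{M}^J_{x^\star}$, and that the non-degeneracy condition $z^\star-x^\star\in\gamma\,\mathrm{ri}(\partial J(x^\star))$ holds. Then there exists a matrix $M_{\mathrm{DR}}$ such that for all $k$ large enough $$z_{k+1}-z_k=M_{\mathrm{DR}}(z_k-z_{k-1})+o(\|z_k-z_{k-1}\|),$$ and, if moreover $\gamma<\frac{1}{\|\nabla^2R(x^\star)\|}$, then all the eigenvalues of $M_{\mathrm{DR}}$ are real. Consequently (for such $\gamma$), provided that $\|x_{k+1}-x_k\|\asymp\rho^k$ for some $\rho\in]\sigma_2,1[$, where $\sigma_2$ is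 the second largest eigenvalue of $M_{\mathrm{DR}}$, the angle $\theta_k$ between $v_k=z_k-z_{k-1}$ and $v_{k-1}$ converges to $0$ and $\{z_k\}$ is a Type I sequence.
   Context: $\mathrm{prox}_{\gamma R}(w)=\mathrm{argmin}_{x}\ \gamma R(x)+\frac12\|x-w\|^2$; $\partial J$ is the convex subdifferential; $\mathrm{ri}$ is the relative interior; $\mathrm{par}(C)$ is the linear subspace parallel to the affine hull of a convex set $C$. A proper convex lower semi-continuous function $J$ on $\mathbb{R}^n$ is partly smooth at $\bar x$ relative to a set $\mathcal{M}_{\bar x}$ if $\mathcal{M}_{\bar x}$ is a $C^2$ manifold (embedded submanifold of $\mathbb{R}^n$) around $\bar x$ and: (Smoothness) $J$ restricted to $\mathcal{M}_{\bar x}$ is $C^2$ around $\bar x$; (Sharpness) the tangent space of $\mathcal{M}_{\bar x}$ at $\bar x$ equals $\mathrm{par}(\partial J(\bar x))^\perp$; (Continuity) the set-valued map $\partial J$ is continuous at $\bar x$ relative to $\mathcal{M}_{\bar x}$. The angle is $\theta_k=\arccos\big(\frac{\langle v_k,v_{k-1}\rangle}{\|v_k\|\|v_{k-1}\|}\big)$. A sequence is called Type I (straight-line trajectory) if $\theta_k\to0$. The notation $a_k\asymp b_k$ means that there are constants $0<c\le C$ with $c\,b_k\le a_k\le C\,b_k$ for all large $k$. If $\nabla^2R(x^\star)=0$, the bound $1/\|\nabla^2R(x^\star)\|$ is read as $+\infty$. *)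

(* Defs.v *)
From mathcomp Require Import all_boot all_order all_algebra.
From mathcomp Require Import all_classical all_reals all_analysis.
From mathcomp Require Import complex.

Set Implicit Arguments.
Unset Strict Implicit.
Unset Printing Implicit Defensive.

Import Order.TTheory GRing.Theory Num.Theory.
Import numFieldNormedType.Exports.

Local Open Scope classical_set_scope.
Local Open Scope ring_scope.

(* Points of R^n are row vectors.  The library norm on 'rV[K]_n is the sup
   norm: it is used for the topology only (limits, derivatives, o(.)), all
   metric notions being taken with respect to [enorm] and [dot]. *)
Section Euclidean.
Context {K : realType} {n : nat}.
Implicit Types (x y : 'rV[K]_n) (A : 'M[K]_n) (C : set 'rV[K]_n).

Definition dot x y : K := (x *m y^T) 0 0.

Definition enorm x : K := Num.sqrt (dot x x).

(* [x *m A^T] is the row encoding of the matrix-vector product A x. *)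
Definition opnorm A : K := sup [set enorm (x *m A^T) | x in [set x | enorm x <= 1]].

Definition orthogonal_complement C : set 'rV[K]_n :=
  [set x | forall y, C y -> dot x y = 0].

Definition affine_hull C : set 'rV[K]_n :=
  [set x | exists (m : nat) (l : 'I_m -> K) (p : 'I_m -> 'rV[K]_n),
     [/\ forall i, C (p i), \sum_i l i = 1 & x = \sum_i l i *: p i]].

Definition par C : set 'rV[K]_n :=
  [set v | exists x y, [/\ affine_hull C x, affine_hull C y & v = x - y]].

Definition relint C : set 'rV[K]_n :=
  [set x | C x /\ exists2 W, nbhs x W & W `&` affine_hull C `<=` C].

End Euclidean.

Section ConvexAnalysis.
Context {K : realType} {n : nat}.
Implicit Types (f : 'rV[K]_n -> \bar K) (x w : 'rV[K]_n).

Definition proper f := (forall x, f x != -oo%E) /\ exists x, (f x < +oo)%E.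

Definition convex_ext f := forall x y (t : K), 0 <= t <= 1 ->
  (f (t *: x + (1 - t) *: y)%R <= t%:E * f x + (1 - t)%:E * f y)%E.

Definition Gamma0 f := [/\ proper f, convex_ext f & lower_semicontinuous f].

Definition dom f : set 'rV[K]_n := [set x | (f x < +oo)%E].

Definition Argmin f : set 'rV[K]_n := [set x | forall y, (f x <= f y)%E].

(* The argmin set; it is a singleton when gamma > 0 and f is in Gamma0. *)
Definition prox (gamma : K) f w : set 'rV[K]_n :=
  Argmin (fun x => (gamma%:E * f x + (2^-1 * enorm (x - w) ^+ 2)%:E)%E).

Definition subdifferential f x : set 'rV[K]_n :=
  [set g | forall y, (f x + (dot g (y - x))%:E <= f y)%E].

End ConvexAnalysis.

Section Smoothness.
Context {K : realType}.

Fixpoint Ck {V W : normedModType K} (k : nat) (U : set V) (f : V -> W) : Prop :=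
  if k is j.+1 then
    (forall x, U x -> differentiable f x) /\
    (forall v, Ck j U (fun x => 'D_v f x))
  else forall x, U x -> {for x, continuous f}.

Definition hessian {n : nat} (f : 'rV[K]_n -> K^o) (x : 'rV[K]_n) : 'M[K]_n :=
  \matrix_(i, j) 'D_(delta_mx 0 i) (fun y => 'D_(delta_mx 0 j) f y) x.

Definition locally_C2 {n : nat} (f : 'rV[K]_n -> \bar K) (x : 'rV[K]_n) :=
  exists U : set 'rV[K]_n,
    [/\ open U, U x, forall y, U y -> f y \is a fin_num &
        Ck 2 U (fun y => fine (f y) : K^o)].

(* Slice charts: phi is a C^2 diffeomorphism from U onto V, with inverse psi,
   which carries M `&` U onto V `&` (R^d x {0}). *)
Definition C2_manifold_around {n : nat} (M : set 'rV[K]_n) (x : 'rV[K]_n) :=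
  M x /\
  exists (d : nat) (U V : set 'rV[K]_n) (phi psi : 'rV[K]_n -> 'rV[K]_n),
    [/\ (d <= n)%N, open U /\ U x, open V,
        [/\ Ck 2 U phi, Ck 2 V psi,
            forall y, U y -> V (phi y) /\ psi (phi y) = y &
            forall y, V y -> U (psi y) /\ phi (psi y) = y] &
        forall y, U y -> (M y <-> forall i : 'I_n, (d <= i)%N -> phi y 0 i = 0)].

(* Velocities at x of curves drawn on M. *)
Definition tangent_space {n : nat} (M : set 'rV[K]_n) (x : 'rV[K]_n) :
    set 'rV[K]_n :=
  [set v | exists c : K^o -> 'rV[K]_n,
     [/\ c 0 = x, \forall t \near (0 : K^o), M (c t) &
         is_derive (0 : K^o) (1 : K^o) c v]].

(* C^2 regularity of the restriction, through a local C^2 extension. *)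
Definition C2_restriction {n : nat} (f : 'rV[K]_n -> \bar K)
    (M : set 'rV[K]_n) (x : 'rV[K]_n) :=
  exists (U : set 'rV[K]_n) (g : 'rV[K]_n -> K^o),
    [/\ open U, U x, Ck 2 U g & forall y, M y -> U y -> f y = (g y)%:E].

End Smoothness.

(* Painleve-Kuratowski limits of S at x relative to M. *)
Section SetValuedContinuity.
Context {T T' : topologicalType}.
Implicit Types (S : T -> set T') (M : set T) (x : T).

Definition inner_limit S M x : set T' :=
  [set g | forall W, nbhs g W -> \forall y \near within M (nbhs x),
     (S y `&` W) !=set0].

Definition outer_limit S M x : set T' :=
  [set g | forall W V, nbhs g W -> nbhs x V ->
     exists2 y, (M `&` V) y & (S y `&` W) !=set0].

Definition set_valued_continuous S M x :=
  S x `<=` inner_limit S M x /\ outer_limit S M x `<=` S x.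

End SetValuedContinuity.

Section PartialSmoothness.
Context {K : realType} {n : nat}.

Definition partly_smooth (J : 'rV[K]_n -> \bar K) (M : set 'rV[K]_n)
    (x : 'rV[K]_n) :=
  [/\ C2_manifold_around M x,
      C2_restriction J M x,
      tangent_space M x = orthogonal_complement (par (subdifferential J x)) &
      set_valued_continuous (subdifferential J) M x].

End PartialSmoothness.

Section DouglasRachford.
Context {K : realType} {n : nat}.
Implicit Types (u z x : nat -> 'rV[K]_n) (A : 'M[K]_n).

(* u 0 is unconstrained: the iteration only produces u 1, u 2, ... *)
Definition Douglas_Rachford (gamma : K) (R J : 'rV[K]_n -> \bar K) u z x :=
  prox gamma J (z 0%N) (x 0%N) /\
  forall k, [/\ prox gamma R (2 *: x k - z k) (u k.+1),
                z k.+1 = z k + u k.+1 - x k &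
                prox gamma J (z k.+1) (x k.+1)].

(* Meaningful for k >= 1 only; v_0 = 0 by truncated subtraction. *)
Definition increment z (k : nat) : 'rV[K]_n := z k - z k.-1.

Definition angle z (k : nat) : K :=
  acos (dot (increment z k) (increment z k.-1) /
        (enorm (increment z k) * enorm (increment z k.-1))).

Definition type_I z := angle z @ \oo --> (0 : K^o).

Definition asymp (a b : nat -> K) :=
  exists c C : K, 0 < c <= C /\
    \forall k \near \oo, c * b k <= a k <= C * b k.

Definition real_spectrum A :=
  forall a : complex K, eigenvalue (map_mx (real_complex K) A) a -> a \is Num.real.

(* The largest (real) eigenvalue that is exceeded by another one.  It is 0 by
   the convention sup set0 = 0 if A has at most one distinct eigenvalue. *)
Definition second_largest_eigenvalue A : K :=
  sup [set a | eigenvalue A a /\ exists2 b, eigenvalue A b & a < b].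

End DouglasRachford.

(* Main.v *)
(* Proximal maps are firmly nonexpansive, so x_k and u_k follow z_k to xs, and
   by nondegeneracy and sharpness x_k eventually lies on the manifold M.  In a
   chart of M the optimality condition of x_k = prox_(gamma J)(z_k) becomes a
   C^1 equation, whose strict differentiability at the limit gives
     x_(k+1) - x_k = (z_(k+1) - z_k) N + o(|z_(k+1) - z_k|)
   with N symmetric and N^2 <= N; symmetry comes from Schwarz' theorem and the
   inequality from the second-order necessary condition.  In the same way
   u_(k+1) - u_k is linearized by L = (1 + gamma H)^-1, H the Hessian of R.
   Hence M_DR = 1/2 (1 + P S) with P = 2 L - 1 and S = 2 N - 1.  When
   gamma |H| < 1 the matrix P is positive definite, so M_DR is self-adjoint and
   positive semidefinite for the inner product of P, and its spectrum is real.

   With lambda the largest eigenvalue, the error e_k (lambda - M_DR) of an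
   increment e_k lives in the image of lambda - M_DR, where M_DR contracts by
   the maximal Rayleigh quotient, an eigenvalue at most sigma_2.  Since
   |e_k| >= c rho^k with rho > sigma_2, a cone argument shows that this error
   is o(|e_k|): increments become collinear and the angles tend to 0. *)

From HB Require Import structures.
Require Import Defs.
From mathcomp Require Import all_boot all_order all_algebra.
From mathcomp Require Import all_classical all_reals all_analysis.
From mathcomp Require Import complex ring lra.

Set Implicit Arguments.
Unset Strict Implicit.
Unset Printing Implicit Defensive.

Import Order.TTheory GRing.Theory Num.Theory.
Import numFieldNormedType.Exports.

Local Open Scope classical_set_scope.
Local Open Scope ring_scope.

(** Differentiability at the limit alone would leave errors of the order of |z_k - zs|, possibly far
    larger than the increments. Strict differentiability compares two moving points and bounds the
    error by their difference; C^1 maps have it by the mean value theorem. It also takes the place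
    of the implicit function theorem: no proximal map is ever differentiated; its optimality
    condition is linearized along the sequence, and the linear equation so obtained is solved by an
    invertible matrix. Positivity of M_DR rests on M_DR P = 1/2 (P + P S P), where N >= 0 gives S >=
    -1 and gamma H^2 <= H gives P^2 <= P. No diagonalization is used: a maximizer of a Rayleigh
    quotient on an invariant subspace is an eigenvector. *)

(** * Inner product, Cauchy-Schwarz for semidefinite forms, comparison of norms *)

Section DotTheory.
Context {K : realType} {n : nat}.
Implicit Types (x y w : 'rV[K]_n) (A B : 'M[K]_n).

Lemma dotE x y : dot x y = \sum_i x 0 i * y 0 i.
Proof. by rewrite /dot mxE; apply: eq_bigr => i _; rewrite mxE. Qed.

Lemma dotC x y : dot x y = dot y x.
Proof. by rewrite !dotE; apply: eq_bigr => i _; rewrite mulrC. Qed.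

Lemma dotDl x y w : dot (x + y) w = dot x w + dot y w.
Proof. by rewrite /dot mulmxDl mxE. Qed.

Lemma dotDr x y w : dot w (x + y) = dot w x + dot w y.
Proof. by rewrite dotC dotDl !(dotC w). Qed.

Lemma dotZl a x y : dot (a *: x) y = a * dot x y.
Proof. by rewrite /dot -scalemxAl mxE. Qed.

Lemma dotZr a x y : dot x (a *: y) = a * dot x y.
Proof. by rewrite dotC dotZl dotC. Qed.

Lemma dotNl x y : dot (- x) y = - dot x y.
Proof. by rewrite -scaleN1r dotZl mulN1r. Qed.

Lemma dotNr x y : dot x (- y) = - dot x y.
Proof. by rewrite dotC dotNl dotC. Qed.

Lemma dotBl x y w : dot (x - y) w = dot x w - dot y w.
Proof. by rewrite dotDl dotNl. Qed.

Lemma dotBr x y w : dot w (x - y) = dot w x - dot w y.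
Proof. by rewrite dotDr dotNr. Qed.

Lemma dot0l x : dot 0 x = 0.
Proof. by rewrite -(scale0r (0 : 'rV[K]_n)) dotZl mul0r. Qed.

Lemma dot0r x : dot x 0 = 0.
Proof. by rewrite dotC dot0l. Qed.

Definition dot_lin := (dotDl, dotDr, dotNl, dotNr, dotZl, dotZr).

Lemma dot_delta x i : dot x (delta_mx 0 i) = x 0 i.
Proof.
rewrite dotE (bigD1 i)//= mxE !eqxx mulr1 big1 ?addr0// => j ji.
by rewrite mxE (negbTE ji) andbF mulr0.
Qed.

Lemma dot_ge0 x : 0 <= dot x x.
Proof. by rewrite dotE sumr_ge0// => i _; rewrite -expr2 sqr_ge0. Qed.

Lemma dot_eq0 x : (dot x x == 0) = (x == 0).
Proof.
apply/eqP/eqP => [|->]; last by rewrite dot0l.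
rewrite dotE => /psumr_eq0P x0; apply/rowP => i; rewrite mxE; apply/eqP.
by rewrite -sqrf_eq0 expr2 x0// => j _; rewrite -expr2 sqr_ge0.
Qed.

Lemma dot_gt0 x : x != 0 -> 0 < dot x x.
Proof. by move=> x0; rewrite lt_def dot_eq0 x0 dot_ge0. Qed.

Lemma dot_mulmxl A x y : dot (x *m A) y = dot x (y *m A^T).
Proof. by rewrite /dot trmx_mul trmxK mulmxA. Qed.

Lemma sqr_enorm x : enorm x ^+ 2 = dot x x.
Proof. by rewrite sqr_sqrtr ?dot_ge0. Qed.

Lemma enorm_ge0 x : 0 <= enorm x.
Proof. exact: sqrtr_ge0. Qed.

Lemma enormZ a x : enorm (a *: x) = `|a| * enorm x.
Proof.
by rewrite /enorm dotZl dotZr mulrA -expr2 sqrtrM ?sqr_ge0// sqrtr_sqr.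
Qed.

Definition psd A := forall x, 0 <= dot (x *m A) x.

(** The form may vanish on a nonzero [y], so the usual test point [(c, - b)] settles only [c > 0];
    for [c = 0] a nonzero [b] would make the form negative somewhere. *)
Lemma psd_CauchySchwarz A x y : A^T = A -> psd A ->
  dot (x *m A) y ^+ 2 <= dot (x *m A) x * dot (y *m A) y.
Proof.
move=> At Ap.
have sym : dot (y *m A) x = dot (x *m A) y by rewrite dot_mulmxl At dotC.
set a := dot (x *m A) x; set b := dot (x *m A) y; set c := dot (y *m A) y.
have H s t : 0 <= s ^+ 2 * a + 2 * s * t * b + t ^+ 2 * c.
  have := Ap (s *: x + t *: y).
  rewrite !mulmxDl -!scalemxAl !dot_lin sym -/a -/b -/c.
  by lra.
have a0 : 0 <= a := Ap x.
have c0 : 0 <= c := Ap y.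
have [c00|c_gt0] := eqVneq c 0; last first.
  have c_gt : 0 < c by rewrite lt_def c_gt0.
  have := H c (- b); rewrite -(pmulr_rge0 _ c_gt).
  move=> h; have : 0 <= c * (a * c - b ^+ 2) by nra.
  by rewrite pmulr_rge0// subr_ge0.
rewrite c00 mulr0; have [->|b0] := eqVneq b 0; first by rewrite expr0n.
(* At this point the form equals [- a - 2 < 0]. *)
have := H 1 (- ((a + 1) / b)); rewrite c00 mulr0 addr0 expr1n mul1r mulr1.
rewrite mulrN mulNr -mulrA divfK//; lra.
Qed.

Lemma psd1 : psd 1%:M.
Proof. by move=> x; rewrite mulmx1 dot_ge0. Qed.

Lemma CauchySchwarz x y : dot x y ^+ 2 <= dot x x * dot y y.
Proof. by have := psd_CauchySchwarz x y (trmx1 _ _) psd1; rewrite !mulmx1. Qed.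

Lemma dot_le_enorm x y : `|dot x y| <= enorm x * enorm y.
Proof.
rewrite -(@ler_pXn2r _ 2)// ?nnegrE ?mulr_ge0 ?enorm_ge0//.
by rewrite exprMn !sqr_enorm -normrX ger0_norm ?sqr_ge0// CauchySchwarz.
Qed.

Lemma enormD x y : enorm (x + y) <= enorm x + enorm y.
Proof.
rewrite -(@ler_pXn2r _ 2)// ?nnegrE ?addr_ge0 ?enorm_ge0//.
rewrite sqr_enorm sqrrD !sqr_enorm !dot_lin (dotC y x).
have := le_trans (ler_norm _) (dot_le_enorm x y); lra.
Qed.

Lemma norm_coord x i : `|x 0 i| <= `|x|.
Proof.
rewrite [leRHS]/Num.norm /= mx_normrE.
by rewrite (le_bigmax _ (fun ij : 'I_1 * 'I_n => `|x ij.1 ij.2|) (0, i)).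
Qed.

Lemma norm_le_coord x e : 0 <= e -> (forall i, `|x 0 i| <= e) -> `|x| <= e.
Proof.
move=> e0 xe; rewrite [leLHS]/Num.norm /= mx_normrE bigmax_le// => -[i j] _ /=.
by rewrite ord1.
Qed.

Lemma norm_le_enorm x : `|x| <= enorm x.
Proof.
apply: norm_le_coord; rewrite ?enorm_ge0// => i.
rewrite -sqrtr_sqr /enorm ler_sqrt ?dot_ge0// dotE (bigD1 i)//= expr2 lerDl.
by rewrite sumr_ge0// => j _; rewrite -expr2 sqr_ge0.
Qed.

Lemma norm_dot_le x y : `|dot x y| <= n%:R * (`|x| * `|y|).
Proof.
rewrite dotE (le_trans (ler_norm_sum _ _ _))//.
rewrite (@le_trans _ _ (\sum_(i < n) `|x| * `|y|))//; last first.
  by rewrite sumr_const card_ord -[leLHS]mulr_natl.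
by apply: ler_sum => i _; rewrite normrM ler_pM// norm_coord.
Qed.

Lemma enorm_le_norm x : enorm x <= n%:R * `|x|.
Proof.
rewrite -(@ler_pXn2r _ 2)// ?nnegrE ?mulr_ge0 ?enorm_ge0//.
rewrite sqr_enorm (le_trans (ler_norm _))// (le_trans (norm_dot_le _ _))//.
rewrite exprMn -expr2 ler_wpM2r ?sqr_ge0// -natrX ler_nat.
by case: (n) => // m; rewrite -mulnn leq_pmulr.
Qed.

End DotTheory.

(** * Strict differentiability *)

Section StrictDifferentiability.
Context {K : realType}.

Lemma near_distP (V : normedModType K) (x : V) (P : set V) :
  (\forall y \near x, P y) <->
  exists2 d : K, 0 < d & forall y, `|y - x| < d -> P y.
Proof.
split=> [/nbhs_ballP[d /= d0 H]|[d d0 H]].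
  by exists d => // y yx; apply: H; rewrite -ball_normE/= distrC.
by apply/nbhs_ballP; exists d => //= y; rewrite -ball_normE/= distrC; exact: H.
Qed.

Lemma continuous_distP (V W : normedModType K) (f : V -> W) x :
  {for x, continuous f} <-> forall e : K, 0 < e ->
    exists2 d : K, 0 < d & forall y, `|y - x| < d -> `|f y - f x| <= e.
Proof.
split=> [/cvgrPdist_le H e /H /near_distP[d d0 h]|H].
  by exists d => // y /h; rewrite distrC.
apply/cvgrPdist_le => e /H[d d0 h]; apply/near_distP; exists d => // y /h.
by rewrite distrC.
Qed.

Lemma mulmx_bounded m n (A : 'M[K]_(m, n)) :
  exists2 k : K, 0 < k & forall v : 'rV[K]_m, `|v *m A| <= k * `|v|.
Proof.
exists (1 + m%:R * `|A|) => [|v]; first by rewrite ltr_pwDl.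
apply: (@le_trans _ _ (m%:R * `|A| * `|v|)); last first.
  by rewrite ler_wpM2r// lerDr.
apply: norm_le_coord => [|j]; first by rewrite !mulr_ge0.
rewrite mxE (le_trans (ler_norm_sum _ _ _))//.
rewrite (@le_trans _ _ (\sum_(i < m) `|A| * `|v|))//; last first.
  by rewrite sumr_const card_ord -[leLHS]mulr_natl mulrA.
apply: ler_sum => i _; rewrite normrM mulrC ler_pM ?norm_coord//.
rewrite [leRHS]/Num.norm /= mx_normrE.
by rewrite (le_bigmax _ (fun ij : 'I_m * 'I_n => `|A ij.1 ij.2|) (i, j)).
Qed.

(** Both points vary, so the error is measured against [y - y']; along a sequence tending to [x]
    these are two consecutive terms. [A] acts on rows from the right. *)
Definition strictly_differentiable m n (f : 'rV[K]_m -> 'rV[K]_n)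
    (A : 'M[K]_(m, n)) (x : 'rV[K]_m) :=
  forall e, 0 < e -> exists2 d, 0 < d & forall y y',
    `|y - x| < d -> `|y' - x| < d ->
    `|f y - f y' - (y - y') *m A| <= e * `|y - y'|.

Lemma strict_lipschitz m n (f : 'rV[K]_m -> 'rV[K]_n) A x :
  strictly_differentiable f A x ->
  exists k d, [/\ 0 < k, 0 < d & forall y y',
    `|y - x| < d -> `|y' - x| < d -> `|f y - f y'| <= k * `|y - y'|].
Proof.
move=> /(_ 1 ltr01)[d d0 H]; have [k k0 kA] := mulmx_bounded A.
exists (1 + k), d; split=> //; first by rewrite addr_gt0.
move=> y y' yx y'x; rewrite -[f y - f y'](subrK ((y - y') *m A)) mulrDl.
by rewrite (le_trans (ler_normD _ _))// lerD// H.
Qed.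

Lemma strict_continuous m n (f : 'rV[K]_m -> 'rV[K]_n) A x :
  strictly_differentiable f A x -> {for x, continuous f}.
Proof.
move=> /strict_lipschitz[k [d [k0 d0 H]]].
apply/continuous_distP => e e0.
exists (Num.min d (e / k)) => [|y]; first by rewrite lt_min d0 divr_gt0.
rewrite lt_min ltr_pdivlMr// mulrC => /andP[yx /ltW ye].
by rewrite (le_trans (H _ _ _ _))// subrr normr0.
Qed.

Lemma strict_comp m n p (f : 'rV[K]_m -> 'rV[K]_n) (g : 'rV[K]_n -> 'rV[K]_p)
    A B x :
  strictly_differentiable f A x -> strictly_differentiable g B (f x) ->
  strictly_differentiable (g \o f) (A *m B) x.
Proof.
move=> sf sg e e0.
have [k [d1 [k0 d10 lf]]] := strict_lipschitz sf.
have [l l0 lB] := mulmx_bounded B.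
have [d2 d20 Hg] : exists2 d, 0 < d & forall y y',
    `|y - f x| < d -> `|y' - f x| < d ->
    `|g y - g y' - (y - y') *m B| <= e / (2 * k) * `|y - y'|.
  by apply: sg; rewrite divr_gt0// mulr_gt0.
have [d3 d30 Hf] : exists2 d, 0 < d & forall y y',
    `|y - x| < d -> `|y' - x| < d ->
    `|f y - f y' - (y - y') *m A| <= e / (2 * l) * `|y - y'|.
  by apply: sf; rewrite divr_gt0// mulr_gt0.
exists (Num.min d1 (Num.min d3 (d2 / k))).
  by rewrite !lt_min d10 d30 divr_gt0.
move=> y y'; rewrite !lt_min => /and3P[y1 y3 y2] /and3P[y1' y3' y2'].
have xx : `|x - x| < d1 by rewrite subrr normr0.
have fy : `|f y - f x| < d2.
  by rewrite (le_lt_trans (lf _ _ y1 xx))// mulrC -ltr_pdivlMr.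
have fy' : `|f y' - f x| < d2.
  by rewrite (le_lt_trans (lf _ _ y1' xx))// mulrC -ltr_pdivlMr.
have -> : (g \o f) y - (g \o f) y' - (y - y') *m (A *m B)
    = (g (f y) - g (f y') - (f y - f y') *m B)
    + (f y - f y' - (y - y') *m A) *m B.
  by rewrite [X in _ = _ + X]mulmxBl mulmxA addrA subrK.
rewrite (le_trans (ler_normD _ _))//.
have h1 := Hg _ _ fy fy'.
have h2 := lB (f y - f y' - (y - y') *m A).
have h3 := Hf _ _ y3 y3'.
have h4 := lf _ _ y1 y1'.
have h5 : e / (2 * k) * `|f y - f y'| <= e / 2 * `|y - y'|.
  have ek : 0 <= e / (2 * k) by rewrite ltW// divr_gt0// mulr_gt0.
  apply: le_trans (ler_wpM2l ek h4) _.
  by rewrite le_eqVlt; apply/orP; left; apply/eqP; field; rewrite gt_eqF.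
have h6 : l * `|f y - f y' - (y - y') *m A| <= e / 2 * `|y - y'|.
  apply: le_trans (ler_wpM2l (ltW l0) h3) _.
  by rewrite le_eqVlt; apply/orP; left; apply/eqP; field; rewrite gt_eqF.
lra.
Qed.

Lemma strict_near m n (f g : 'rV[K]_m -> 'rV[K]_n) A x :
  (\forall y \near x, f y = g y) ->
  strictly_differentiable f A x -> strictly_differentiable g A x.
Proof.
move=> /near_distP[d1 d10 fg] sf e e0; have [d d0 H] := sf e e0.
exists (Num.min d1 d); first by rewrite lt_min d10.
move=> y y'; rewrite !lt_min => /andP[y1 y2] /andP[y1' y2'].
by rewrite -!fg ?H.
Qed.

Lemma strict_mulmx m n (A : 'M[K]_(m, n)) x :
  strictly_differentiable (fun y => y *m A) A x.
Proof.
move=> e e0; exists 1 => // y y' _ _.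
by rewrite mulmxBl subrr normr0 mulr_ge0// ltW.
Qed.

Lemma strict_affine m n (f : 'rV[K]_m -> 'rV[K]_n) A x (a : K) c :
  strictly_differentiable f A x ->
  strictly_differentiable (fun y => a *: f y + c) (a *: A) x.
Proof.
move=> sf e e0; have a0 : 0 < 1 + `|a| by rewrite ltr_pwDl.
have [d d0 H] := sf (e / (1 + `|a|)) (divr_gt0 e0 a0).
exists d => // y y' yx y'x.
have -> : a *: f y + c - (a *: f y' + c) - (y - y') *m (a *: A)
    = a *: (f y - f y' - (y - y') *m A).
  by rewrite -scalemxAr !scalerBr opprD addrACA subrr addr0.
have h := H _ _ yx y'x; rewrite normrZ.
apply: (@le_trans _ _ ((1 + `|a|) * (e / (1 + `|a|) * `|y - y'|))).
  by rewrite ler_pM// lerDr.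
by rewrite mulrA mulrCA divff ?mulr1// gt_eqF.
Qed.

End StrictDifferentiability.

(** * Mean value theorem; C^1 maps are strictly differentiable *)

Section MeanValue.
Context {K : realType}.

Lemma is_derive_segment (V W : normedModType K) (f : V -> W) y w (t : K) :
  differentiable f (y + t *: w) ->
  is_derive t (1 : K) (fun s : K => f (y + s *: w)) ('D_w f (y + t *: w)).
Proof.
move=> df; pose c : K -> V := cst y + *:%R^~ w.
have dc : differentiable c t by apply: differentiableD => //; exact: ex_diff.
have df' : differentiable f (c t) by [].
have dfc : differentiable (f \o c) t by exact: differentiable_comp.
apply: DeriveDef; first exact/derivable1_diffP.
rewrite -[LHS]/('D_1 (f \o c) t) deriveE// diff_comp//= deriveE//.
by rewrite diffD// diff_cst diff_val /= scale1r [0 1 + w]add0r.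
Qed.

Lemma mean_value_segment (V : normedModType K) (f : V -> K^o) y w :
  (forall t : K, 0 <= t <= 1 -> differentiable f (y + t *: w)) ->
  exists2 t : K, 0 < t < 1 & f (y + w) - f y = 'D_w f (y + t *: w).
Proof.
move=> df; pose g (s : K) : K := f (y + s *: w).
have dg (t : K) : t \in `[0, 1]%R -> is_derive t (1 : K) g ('D_w f (y + t *:
  w)).
  by rewrite in_itv/= => t01; apply: is_derive_segment; exact: df.
have dg' (t : K) : t \in `]0, 1[%R -> is_derive t (1 : K) g ('D_w f (y + t *:
  w)).
  by move=> t01; apply: dg; rewrite in_itv/= !ltW// (itvP t01).
have cg : {within `[0, 1], continuous g}.
  by apply: derivable_within_continuous => t /dg -[].
have [t t01 E] := MVT ltr01 dg' cg; move: t01 E.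
rewrite in_itv/= /g scale1r scale0r addr0 subr0 mulr1 => t01 E; by exists t.
Qed.

End MeanValue.

Lemma dist_forall (K : realType) (V : normedModType K) (I : finType)
    (P : I -> set V) x :
  (forall i, exists2 d : K, 0 < d & forall y, `|y - x| < d -> P i y) ->
  exists2 d : K, 0 < d & forall y, `|y - x| < d -> forall i, P i y.
Proof.
move=> H; apply/near_distP; apply: filter_forall => i.
by apply/near_distP; exact: H.
Qed.

Section Gradient.
Context {K : realType} {n : nat}.
Implicit Types (x y v : 'rV[K]_n).

Lemma derive_sum_delta (W : normedModType K) (f : 'rV[K]_n -> W) x v :
  differentiable f x -> 'D_v f x = \sum_i v 0 i *: 'D_(delta_mx 0 i) f x.
Proof.
move=> df; rewrite deriveE// [in LHS](row_sum_delta v) linear_sum.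
by apply: eq_bigr => i _; rewrite linearZ deriveE.
Qed.

(** Balls are convex, so the mean value theorem on the segment from [y'] to [y] expresses the
    difference by partial derivatives at one point near [x], each close to its value at [x]. *)
Lemma strict_C1_scalar (f : 'rV[K]_n -> K^o) (U : set 'rV[K]_n) x :
  open U -> U x -> (forall y, U y -> differentiable f y) ->
  (forall i e, 0 < e -> exists2 d : K, 0 < d & forall y, `|y - x| < d ->
     `|'D_(delta_mx 0 i) f y - 'D_(delta_mx 0 i) f x| <= e) ->
  forall e, 0 < e -> exists2 d, 0 < d & forall y y',
    `|y - x| < d -> `|y' - x| < d ->
    `|f y - f y' - ((y - y') *m \col_i 'D_(delta_mx 0 i) f x) 0 0|
      <= e * `|y - y'|.
Proof.
move=> oU Ux df cf e e0.
have [r r0 Ur] : exists2 d : K, 0 < d & forall y, `|y - x| < d -> U y.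
  by apply/near_distP; exact: open_nbhs_nbhs.
(* [n.+1] absorbs the sum over [n] coordinates and stays nonzero when [n = 0]. *)
have e1 : 0 < e / n.+1%:R by rewrite divr_gt0.
have [d d0 Hd] : exists2 d : K, 0 < d & forall y, `|y - x| < d -> forall i,
    `|'D_(delta_mx 0 i) f y - 'D_(delta_mx 0 i) f x| <= e / n.+1%:R.
  by apply: dist_forall => i; exact: cf.
exists (Num.min r d) => [|y y' yx y'x]; first by rewrite lt_min r0.
have seg t : 0 <= t <= 1 -> `|y' + t *: (y - y') - x| < Num.min r d.
  move=> /andP[t0 t1].
  have -> : y' + t *: (y - y') - x = t *: (y - x) + (1 - t) *: (y' - x).
    by apply/rowP => i; rewrite !mxE; ring.
  rewrite (le_lt_trans (ler_normD _ _))// !normrZ !ger0_norm ?subr_ge0//.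
  set m := Num.min r d in yx y'x *.
  have [->|t_neq0] := eqVneq t 0; first by rewrite mul0r add0r subr0 mul1r.
  have h1 : 0 < t * (m - `|y - x|) by rewrite mulr_gt0 ?subr_gt0// lt_def
    t_neq0.
  have h2 : 0 <= (1 - t) * (m - `|y' - x|) by rewrite mulr_ge0 ?subr_ge0// ltW.
  lra.
have [|t t01] := @mean_value_segment K _ f y' (y - y').
  move=> t /seg; rewrite lt_min => /andP[/Ur Uz _]; exact: df.
have yE : y' + (y - y') = y by rewrite addrC subrK.
rewrite yE => ->.
have : `|y' + t *: (y - y') - x| < Num.min r d.
  by apply: seg; case/andP: t01 => *; rewrite !ltW.
set z := y' + _; rewrite lt_min => /andP[/Ur Uz /Hd Hz].
rewrite derive_sum_delta; last exact: df.
rewrite mxE -sumrB (le_trans (ler_norm_sum _ _ _))//.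
apply: (@le_trans _ _ (\sum_(i < n) `|y - y'| * (e / n.+1%:R))); last first.
  rewrite sumr_const card_ord -[leLHS]mulr_natl mulrCA mulrC ler_wpM2r//.
  by rewrite mulrCA ger_pMr// ler_pdivrMr// mul1r ler_nat.
apply: ler_sum => i _; rewrite [X in _ * X]mxE -mulrBr normrM ler_pM
  ?norm_coord//.
Qed.

End Gradient.

Section StrictDot.
Context {K : realType}.

Lemma strict_dot m n (a b : 'rV[K]_m -> 'rV[K]_n) A B x :
  strictly_differentiable a A x -> strictly_differentiable b B x ->
  forall e, 0 < e -> exists2 d, 0 < d & forall y y',
    `|y - x| < d -> `|y' - x| < d ->
    `|dot (a y) (b y) - dot (a y') (b y')
      - ((y - y') *m (A *m (b x)^T + B *m (a x)^T)) 0 0| <= e * `|y - y'|.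
Proof.
move=> sa sb e e0.
have [k k0 kA] := mulmx_bounded A; have [l l0 lB] := mulmx_bounded B.
(* [c] majorizes the bounds of the four products into which the error is split below; [e1 <= 1]
   keeps [a] and [b] bounded near [x]. *)
pose c := 1 + n%:R * (`|b x| + 1 + k + (`|a x| + 1) + l).
have c0 : 0 < c by rewrite ltr_pwDl// mulr_ge0// !addr_ge0// ltW.
pose e1 := Num.min 1 (e / c).
have e10 : 0 < e1 by rewrite lt_min ltr01 divr_gt0.
have [d1 d10 H1] := sa e1 e10; have [d2 d20 H2] := sb e1 e10.
have [d3 d30 H3] := (continuous_distP _ _).1 (strict_continuous sa) e1 e10.
have [d4 d40 H4] := (continuous_distP _ _).1 (strict_continuous sb) e1 e10.
exists (Num.min (Num.min d1 d2) (Num.min d3 d4)).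
  by rewrite !lt_min d10 d20 d30 d40.
move=> y y'; rewrite !lt_min => /andP[/andP[y1 y2] /andP[y3 y4]].
move=> /andP[/andP[y1' y2'] /andP[y3' y4']].
have := H1 _ _ y1 y1'; have := H2 _ _ y2 y2'.
have := H3 _ y3'; have := H4 _ y4.
set v := y - y'; set ea := _ - _ - v *m A; set eb := _ - _ - v *m B => hb ha he
  hf.
have -> : dot (a y) (b y) - dot (a y') (b y')
      - (v *m (A *m (b x)^T + B *m (a x)^T)) 0 0 =
   dot ea (b y) + dot (v *m A) (b y - b x) + dot (a y') eb
   + dot (a y' - a x) (v *m B).
  have -> : (v *m (A *m (b x)^T + B *m (a x)^T)) 0 0 =
      dot (v *m A) (b x) + dot (a x) (v *m B).
    by rewrite mulmxDr !mulmxA mxE [dot (a x) _]dotC.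
  by rewrite /ea /eb !dot_lin; ring.
have e11 : e1 <= 1 by rewrite ge_min lexx.
have bx : `|b y| <= `|b x| + 1.
  rewrite -[b y](subrK (b x)) (le_trans (ler_normD _ _))// addrC lerD2l.
  exact: le_trans hb _.
have ax : `|a y'| <= `|a x| + 1.
  rewrite -[a y'](subrK (a x)) (le_trans (ler_normD _ _))// addrC lerD2l.
  exact: le_trans ha _.
have i1 : `|dot ea (b y)| <= n%:R * (e1 * `|v| * (`|b x| + 1)).
  by rewrite (le_trans (norm_dot_le _ _))// ler_wpM2l// ler_pM.
have i2 : `|dot (v *m A) (b y - b x)| <= n%:R * (k * `|v| * e1).
  by rewrite (le_trans (norm_dot_le _ _))// ler_wpM2l// ler_pM.
have i3 : `|dot (a y') eb| <= n%:R * ((`|a x| + 1) * (e1 * `|v|)).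
  by rewrite (le_trans (norm_dot_le _ _))// ler_wpM2l// ler_pM.
have i4 : `|dot (a y' - a x) (v *m B)| <= n%:R * (e1 * (l * `|v|)).
  by rewrite (le_trans (norm_dot_le _ _))// ler_wpM2l// ler_pM.
have i5 : c * e1 * `|v| <= e * `|v|.
  rewrite ler_wpM2r// mulrC -ler_pdivlMr//.
  by rewrite ge_min lexx orbT.
rewrite (le_trans (ler_normD _ _))//.
have j1 := ler_normD (dot ea (b y) + dot (v *m A) (b y - b x)) (dot (a y') eb).
have j2 := ler_normD (dot ea (b y)) (dot (v *m A) (b y - b x)).
have j3 : 0 <= e1 * `|v| by rewrite mulr_ge0// ltW.
have : c * e1 * `|v| = e1 * `|v| + n%:R * (e1 * `|v| * (`|b x| + 1))
   + n%:R * (k * `|v| * e1) + n%:R * ((`|a x| + 1) * (e1 * `|v|))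
   + n%:R * (e1 * (l * `|v|)) by rewrite /c; ring.
lra.
Qed.

Lemma strict_coord m p (f : 'rV[K]_m -> 'rV[K]_p) (s : 'I_p -> 'cV[K]_m) x :
  (forall j e, 0 < e -> exists2 d, 0 < d & forall y y',
    `|y - x| < d -> `|y' - x| < d ->
    `|f y 0 j - f y' 0 j - ((y - y') *m s j) 0 0| <= e * `|y - y'|) ->
  strictly_differentiable f (\matrix_(i, j) s j i 0) x.
Proof.
move=> Hs e e0.
(* The radius itself is the variable [t] near 0, which turns finitely many radii into a common
   one. *)
have [] := @dist_forall K K^o 'I_p (fun j t => forall y y',
    `|y - x| < `|t| -> `|y' - x| < `|t| ->
    `|f y 0 j - f y' 0 j - ((y - y') *m s j) 0 0| <= e * `|y - y'|) 0.
  move=> j; have [d d0 H] := Hs j e e0; exists d => // t.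
  rewrite subr0 => td y y' yt y't; apply: H; exact: lt_trans td.
move=> d d0 H; exists (d / 2) => [|y y' yd y'd]; first by rewrite divr_gt0.
apply: norm_le_coord => [|j]; first by rewrite mulr_ge0// ltW.
have d2 : `|d / 2| = d / 2 by rewrite gtr0_norm// divr_gt0.
have hd : `|d / 2 - 0| < d by rewrite subr0 d2; lra.
have := H _ hd j y y'; rewrite d2 => /(_ yd y'd); rewrite !mxE => h.
by under [X in _ - _ - X]eq_bigr do rewrite [X in _ * X]mxE.
Qed.

Lemma strict_row_dot m n p (a : 'rV[K]_m -> 'rV[K]_n)
    (b : 'I_p -> 'rV[K]_m -> 'rV[K]_n) A x :
  strictly_differentiable a A x ->
  (forall j, exists B, strictly_differentiable (b j) B x) ->
  exists S, strictly_differentiable (fun y => \row_j dot (a y) (b j y)) S x.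
Proof.
move=> sa /choice[B sB]; eexists.
apply: (@strict_coord _ _ _ (fun j => A *m (b j x)^T + B j *m (a x)^T)) => j e
  e0.
have [d d0 H] := strict_dot sa (sB j) e0; exists d => // y y' yd y'd.
by rewrite !mxE; have := H _ _ yd y'd; rewrite !mxE.
Qed.

Lemma strict_C1 n (f : 'rV[K]_n -> 'rV[K]_n) (U : set 'rV[K]_n) x :
  open U -> U x -> Ck 1 U f -> strictly_differentiable f (jacobian f x) x.
Proof.
move=> oU Ux [df cf].
have [r r0 Ur] : exists2 d : K, 0 < d & forall y, `|y - x| < d -> U y.
  by apply/near_distP; exact: open_nbhs_nbhs.
have dfj j z : U z -> differentiable (fun y => f y 0 j : K^o) z.
  move=> Uz; apply: (@differentiable_comp _ _ _ _ f (fun M => M 0 j : K^o)).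
    exact: df.
  exact: differentiable_coord.
have Djf j z v : U z -> 'D_v (fun y => f y 0 j : K^o) z = ('D_v f z) 0 j.
  move=> Uz; rewrite derive_mx ?mxE//; exact/diff_derivable/df.
have -> : jacobian f x = \matrix_(i, j)
    (\col_i 'D_(delta_mx 0 i) (fun y => f y 0 j : K^o) x) i 0.
  apply/matrixP => i j; rewrite [RHS]mxE [RHS]mxE Djf//.
  rewrite deriveEjacobian; last exact: df.
  by have := rowE i (jacobian f x) => /rowP/(_ j); rewrite mxE.
apply: (@strict_coord _ _ _
  (fun j => \col_i 'D_(delta_mx 0 i) (fun y => f y 0 j : K^o) x)) => j.
apply: (strict_C1_scalar oU Ux (dfj j)) => i e e0.
have [d d0 Hd] := (continuous_distP _ _).1 (cf (delta_mx 0 i) x Ux) e e0.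
exists (Num.min r d) => [|y]; first by rewrite lt_min r0.
rewrite lt_min => /andP[/Ur Uy /Hd h]; rewrite !Djf//.
by have := norm_coord ('D_(delta_mx 0 i) f y - 'D_(delta_mx 0 i) f x) j;
  rewrite !mxE => /le_trans; apply.
Qed.

Definition gradient n (f : 'rV[K]_n -> K^o) (y : 'rV[K]_n) : 'rV[K]_n :=
  \row_j 'D_(delta_mx 0 j) f y.

Lemma derive_gradient n (f : 'rV[K]_n -> K^o) y v :
  differentiable f y -> 'D_v f y = dot (gradient f y) v.
Proof.
move=> df; rewrite derive_sum_delta// dotE.
by apply: eq_bigr => i _; rewrite mxE mulrC.
Qed.

Lemma strict_gradient n (f : 'rV[K]_n -> K^o) (U : set 'rV[K]_n) x :
  open U -> U x -> Ck 2 U f ->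
  strictly_differentiable (gradient f) (hessian f x) x.
Proof.
move=> oU Ux [_ C1].
have -> : hessian f x = \matrix_(i, j)
    (\col_i 'D_(delta_mx 0 i) (fun y => 'D_(delta_mx 0 j) f y) x) i 0.
  by apply/matrixP => i j; rewrite !mxE.
apply: (@strict_coord _ _ _
  (fun j => \col_i 'D_(delta_mx 0 i) (fun y => 'D_(delta_mx 0 j) f y) x)) => j
    e e0.
have [df cf] := C1 (delta_mx 0 j).
have [|d d0 H] := strict_C1_scalar oU Ux df _ e0.
  move=> i; exact: (continuous_distP _ _).1 (cf (delta_mx 0 i) x Ux).
exists d => // y y' yd y'd.
by rewrite [gradient f y 0 j]mxE [gradient f y' 0 j]mxE; exact: H.
Qed.

End StrictDot.

(** * Second-order conditions *)

Section Translate.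
Context {K : realType} {V W : normedModType K}.

Lemma differentiable_translate (f : V -> W) c x :
  differentiable f (x + c) -> differentiable (fun y => f (y + c)) x.
Proof.
by move=> df; apply: (@differentiable_comp _ _ _ _ (fun y => y + c)).
Qed.

Lemma derive_translate (f : V -> W) c x v :
  'D_v (fun y => f (y + c)) x = 'D_v f (x + c).
Proof.
by rewrite /derive /=; under [in LHS]eq_fun do rewrite -addrA.
Qed.

End Translate.

Section SecondOrder.
Context {K : realType} {n : nat}.
Implicit Types (f : 'rV[K]_n -> K^o) (G : 'rV[K]_n -> 'rV[K]_n).
Implicit Types (x y p v : 'rV[K]_n).

Lemma dist_segment x v d : 0 < d ->
  exists2 r : K, 0 < r & forall t : K, `|t| < r -> `|x + t *: v - x| < d.
Proof.
move=> d0; have v0 : 0 < 1 + `|v| by rewrite ltr_pwDl.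
exists (d / (1 + `|v|)) => [|t]; first by rewrite divr_gt0.
rewrite ltr_pdivlMr// => td; rewrite addrC addKr normrZ.
by apply: le_lt_trans td; rewrite ler_wpM2l// lerDr.
Qed.

(** [f (x + t v) - t <p, v>] has a local minimum at [t = 0]. The inequality is only required near
    [x], which admits nonconvex functions such as those read in a chart. *)
Lemma Fermat_subgradient f x p :
  (\forall y \near x, differentiable f y) ->
  (\forall y \near x, f x + dot p (y - x) <= f y) ->
  forall v, 'D_v f x = dot p v.
Proof.
move=> /near_distP[d1 d10 df] /near_distP[d2 d20 fp] v.
have d0 : 0 < Num.min d1 d2 by rewrite lt_min d10.
have [r r0 Hr] := dist_segment x v d0.
have seg (t : K) : t \in `](- r), r[%R -> `|x + t *: v - x| < Num.min d1 d2.
  by rewrite in_itv/= => tr; apply: Hr; rewrite ltr_norml.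
pose g (t : K) : K := f (x + t *: v) - t * dot p v.
have dg (t : K) : t \in `](- r), r[%R ->
    is_derive t (1 : K) g ('D_v f (x + t *: v) - dot p v).
  move=> /seg; rewrite lt_min => /andP[/df dt _].
  have := is_derive_segment dt => h1.
  have h2 : is_derive t (1 : K) (fun s : K => s * dot p v) (dot p v).
    rewrite (_ : (fun s : K => _) = dot p v \*: id); last first.
      by apply/funext => s /=; rewrite mulrC.
    by apply: is_derive_eq; rewrite [_ *: _]mulr1.
  exact: is_deriveB.
have r00 : (0 : K) \in `](- r), r[%R by rewrite in_itv/= oppr_lt0 r0.
have : is_derive (0 : K) (1 : K) g 0.
  apply: (@derive1_at_min _ g (- r) r) => //.
  - by rewrite ge0_cp// ltW.
  - by move=> t /dg [].
  - move=> t /seg; rewrite lt_min => /andP[_ /fp].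
    rewrite /g scale0r addr0 mul0r subr0 [x + _]addrC addrK dotZr; lra.
move=> [_]; have [_ ->] := dg 0 r00; rewrite scale0r addr0 => /eqP.
by rewrite subr_eq0 => /eqP.
Qed.

Definition has_gradient_near f G x := \forall y \near x,
  differentiable f y /\ forall v, 'D_v f y = dot (G y) v.

(** The mixed difference is the variation over [t a] of [F y = f (y + t b) - f y]. One mean value
    theorem turns it into a difference of two values of [G] near [x], which strict differentiability
    evaluates; second derivatives away from [x] never occur. *)
Lemma second_difference f G H x a b :
  has_gradient_near f G x -> strictly_differentiable G H x ->
  forall e, 0 < e -> exists2 r : K, 0 < r & forall t : K, 0 < t < r ->
  `|f (x + t *: b + t *: a) - f (x + t *: a) - (f (x + t *: b) - f x)
    - t ^+ 2 * dot (b *m H) a| <= t ^+ 2 * e.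
Proof.
move=> /near_distP[d1 d10 df] sG e e0.
pose c := 1 + n%:R * (`|b| * `|a|).
have c0 : 0 < c by rewrite ltr_pwDl// !mulr_ge0.
have [d2 d20 HG] := sG _ (divr_gt0 e0 c0).
(* Half the radius, since points of the parallelogram move along [a] and [b] at once. *)
have d0 : 0 < Num.min d1 d2 / 2 by rewrite divr_gt0// lt_min d10.
have [r1 r10 Ha] := dist_segment 0 a d0.
have [r2 r20 Hb] := dist_segment 0 b d0.
exists (Num.min r1 r2) => [|t]; first by rewrite lt_min r10.
rewrite lt_min => /and3P[t0 t1 t2].
have near_seg (s s' : K) : 0 <= s <= 1 -> 0 <= s' <= 1 ->
    `|x + (s' * t) *: b + s *: (t *: a) - x| < Num.min d1 d2.
  move=> /andP[s0 s1] /andP[s'0 s'1]; rewrite -(addrA x) (addrC x) addrK.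
  have := Ha (s * t); have := Hb (s' * t).
  rewrite !add0r !subr0 !ger0_norm ?mulr_ge0 ?(ltW t0)// => hb ha.
  have /hb hb' : s' * t < r2 by apply: le_lt_trans t2; rewrite ger_pMl.
  have /ha ha' : s * t < r1 by apply: le_lt_trans t1; rewrite ger_pMl.
  rewrite scalerA (le_lt_trans (ler_normD _ _))//.
  lra.
pose F y : K^o := f (y + t *: b) - f y.
have s01 (s : K) : 0 <= s <= 1 -> `|x + s *: (t *: a) - x| < Num.min d1 d2.
  move=> s1; have := near_seg s 0 s1; rewrite lexx ler01 mul0r scale0r addr0.
  by apply.
have s11 (s : K) : 0 <= s <= 1 ->
    `|x + s *: (t *: a) + t *: b - x| < Num.min d1 d2.
  move=> s1; have := near_seg s 1 s1; rewrite lexx ler01 mul1r.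
  by rewrite [x + _ + s *: _]addrAC; apply.
have dF (s : K) : 0 <= s <= 1 -> differentiable F (x + s *: (t *: a)) /\
   'D_(t *: a) F (x + s *: (t *: a)) =
   dot (G (x + s *: (t *: a) + t *: b) - G (x + s *: (t *: a))) (t *: a).
  move=> s1; set z := x + s *: _.
  have := s01 _ s1; have := s11 _ s1.
  rewrite !lt_min => /andP[/df[df1 D1] _] /andP[/df[df2 D2] _].
  have dsb := differentiable_translate df1.
  have Dsb := derive_translate f (t *: b) z (t *: a).
  split; first exact: differentiableB.
  rewrite (@deriveB _ _ _ (fun y => f (y + t *: b)) f); last 2 first.
  - exact: diff_derivable.
  - exact: diff_derivable.
  by rewrite Dsb D1 D2 dotBl.
have [s s1 E] := @mean_value_segment K _ F x (t *: a) (fun s h => (dF s h).1).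
have s1' : 0 <= s <= 1 by case/andP: s1 => *; rewrite !ltW.
have -> : f (x + t *: b + t *: a) - f (x + t *: a) - (f (x + t *: b) - f x)
   = F (x + t *: a) - F x by rewrite /F [x + t *: b + _]addrAC.
rewrite E (dF s s1').2.
have := s01 _ s1'; have := s11 _ s1'; set z := x + s *: _.
rewrite !lt_min => /andP[_ z2'] /andP[_ z2].
have := HG _ _ z2' z2; rewrite [z + _]addrC addrK.
set er := _ - _ - _ => her.
have -> : dot (G (t *: b + z) - G z) (t *: a) - t ^+ 2 * dot (b *m H) a
   = t * dot er a.
  by rewrite /er -scalemxAl !dot_lin; ring.
rewrite normrM (gtr0_norm t0) expr2 -mulrA ler_wpM2l ?(ltW t0)//.
rewrite (le_trans (norm_dot_le _ _))//.
rewrite (@le_trans _ _ (n%:R * (e / c * `|t *: b| * `|a|)))//.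
  by rewrite ler_wpM2l// ler_wpM2r.
rewrite normrZ gtr0_norm//.
have -> : n%:R * (e / c * (t * `|b|) * `|a|)
  = t * (n%:R * (`|b| * `|a|) * (e / c)) by ring.
rewrite ler_wpM2l ?(ltW t0)// mulrCA ger_pMr//.
by rewrite ler_pdivrMr// mul1r /c lerDr.
Qed.

(** The mixed difference is symmetric in [a] and [b], while its two limits are [<b H, a>] and
    [<a H, b>]. A gap [e] between them contradicts an accuracy of [e / 3] for each. *)
Lemma strict_hessian_sym f G H x :
  has_gradient_near f G x -> strictly_differentiable G H x -> H^T = H.
Proof.
move=> fG sG.
have key a b : dot (b *m H) a = dot (a *m H) b.
  apply/eqP; rewrite -subr_eq0 -normr_le0 leNgt; apply/negP => /[dup] h0.
  set q := dot (b *m H) a in h0 *; set q' := dot (a *m H) b in h0 *.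
  set e := `|q - q'| in h0 * => _.
  have e3 : 0 < e / 3 by rewrite divr_gt0.
  have [r1 r10 H1] := second_difference a b fG sG e3.
  have [r2 r20 H2] := second_difference b a fG sG e3.
  pose t := Num.min r1 r2 / 2.
  have m0 : 0 < Num.min r1 r2 by rewrite lt_min r10.
  have t0 : 0 < t by rewrite divr_gt0.
  have tm : t < Num.min r1 r2 by rewrite /t; lra.
  move: tm; rewrite lt_min => /andP[tr1 tr2].
  have := H1 t; rewrite t0 tr1 => /(_ isT) h1.
  have := H2 t; rewrite t0 tr2 => /(_ isT) h2.
  move: h1 h2; rewrite -/q -/q' [x + t *: b + _]addrAC.
  set u1 := f _; set u2 := f _; set u3 := f _; set u4 := f _ => h1 h2.
  have : t ^+ 2 * e <= t ^+ 2 * (2 / 3 * e).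
    rewrite /e -[X in X * `|_|]ger0_norm ?sqr_ge0// -normrM.
    have -> : t ^+ 2 * (q - q') = (u1 - u3 - (u2 - u4) - t ^+ 2 * q')
      - (u1 - u2 - (u3 - u4) - t ^+ 2 * q) by ring.
    rewrite (le_trans (ler_normB _ _))// -/e; lra.
  rewrite ler_pM2l ?exprn_gt0//; lra.
apply/matrixP => i j; rewrite mxE.
have := key (delta_mx 0 i) (delta_mx 0 j); rewrite !dot_delta -!rowE !mxE.
by [].
Qed.

(** By the mean value theorem [f (x + t v) - f x - t <G x, v> = t <G z - G x, v>] with
    [z = x + s t v], which is [s t^2 <v H, v>] up to a smaller error; a negative form would break
    the support inequality. *)
Lemma strict_hessian_psd f G H x :
  has_gradient_near f G x -> strictly_differentiable G H x ->
  (\forall y \near x, f x + dot (G x) (y - x) <= f y) -> psd H.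
Proof.
move=> /near_distP[d1 d10 df] sG /near_distP[d2 d20 fG] v.
rewrite leNgt; apply/negP => q0; set q := dot _ _ in q0.
pose c := 1 + n%:R * (`|v| * `|v|).
have c0 : 0 < c by rewrite ltr_pwDl// !mulr_ge0.
have e0 : 0 < - q / 2 by rewrite divr_gt0// oppr_gt0.
have [d3 d30 HG] := sG _ (divr_gt0 e0 c0).
have d0 : 0 < Num.min d1 (Num.min d2 d3) by rewrite !lt_min d10 d20.
have [r r0 Hr] := dist_segment x v d0.
have [t t0 tr] : exists2 t, 0 < t & t < r by exists (r / 2); lra.
have seg (s : K) : 0 <= s <= 1 -> `|x + s *: (t *: v) - x| < Num.min d1
  (Num.min d2 d3).
  move=> /andP[s0 s1]; rewrite scalerA; apply: Hr.
  have st0 : 0 <= s * t by rewrite mulr_ge0// ltW.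
  by rewrite ger0_norm//; apply: le_lt_trans tr; rewrite ger_pMl.
have [|s s01 E] := @mean_value_segment K _ f x (t *: v).
  by move=> s /seg; rewrite lt_min => /andP[/df[]].
have s01' : 0 <= s <= 1 by case/andP: s01 => *; rewrite !ltW.
have /andP[s0 _] := s01.
have := seg 1; rewrite ler01 lexx scale1r => /(_ isT).
rewrite !lt_min => /and3P[_ /fG f1 _]; move: f1.
rewrite addrAC subrr add0r.
have := seg s s01'; set z := x + _ in E *.
rewrite !lt_min => /and3P[/df[_ Dz] _ z3].
have x3 : `|x - x| < d3 by rewrite subrr normr0.
have := HG _ _ z3 x3; rewrite [z - x]addrC addKr.
set er := _ - _ - _ => her.
rewrite addrC -lerBrDr E Dz -subr_ge0 -dotBl.
have -> : G z - G x = er + s *: (t *: v) *m H by rewrite /er subrK.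
clearbody er.
rewrite -!scalemxAl !dot_lin -/q.
have : `|dot er v| <= s * t * (- q / 2).
  rewrite (le_trans (norm_dot_le _ _))//.
  rewrite (@le_trans _ _ (n%:R * (- q / 2 / c * `|s *: (t *: v)| * `|v|)))//.
    by rewrite ler_wpM2l// ler_wpM2r.
  rewrite !normrZ (gtr0_norm t0) (gtr0_norm s0).
  have -> : n%:R * (- q / 2 / c * (s * (t * `|v|)) * `|v|)
    = s * t * (n%:R * (`|v| * `|v|) * (- q / 2 / c)) by ring.
  rewrite ler_wpM2l ?mulr_ge0 ?(ltW s0) ?(ltW t0)//.
  move: e0; set w := - q / 2 => w0; rewrite mulrCA ger_pMr//.
  by rewrite ler_pdivrMr// mul1r /c lerDr.
move=> /(le_trans (ler_norm _)) h.
have st0 : 0 < s * t by rewrite mulr_gt0.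
have tn : t * (dot er v + s * t * (q / 2)) <= 0 by rewrite pmulr_rle0//; lra.
have : 0 < t * (s * t * (- q / 2)) by rewrite mulr_gt0// mulr_gt0// mulr_gt0.
lra.
Qed.

End SecondOrder.

(** * Proximal points and subgradients *)

Section Proximal.
Context {K : realType} {n : nat}.
Implicit Types (f : 'rV[K]_n -> \bar K) (g x y w : 'rV[K]_n).

Lemma subgradient_fin_num f x g :
  Defs.proper f -> subdifferential f x g -> f x \is a fin_num.
Proof.
move=> [fNy [y fy]] fg; rewrite fin_numE fNy/=; apply/eqP => fx.
by have := fg y; rewrite fx addye// leye_eq => /eqP fyy; rewrite fyy ltxx in fy.
Qed.

Lemma subgradient_fine f x y g : f x \is a fin_num -> f y \is a fin_num ->
  subdifferential f x g -> fine (f x) + dot g (y - x) <= fine (f y).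
Proof.
by move=> fx fy /(_ y); rewrite -[f x]fineK// -[f y]fineK.
Qed.

Lemma subdifferential_monotone f x x' g g' : Defs.proper f ->
  subdifferential f x g -> subdifferential f x' g' ->
  0 <= dot (g - g') (x - x').
Proof.
move=> pf gx gx'; have fx := subgradient_fin_num pf gx.
have fx' := subgradient_fin_num pf gx'.
have := subgradient_fine fx fx' gx; have := subgradient_fine fx' fx gx'.
rewrite -[x' - x]opprB !dot_lin; lra.
Qed.

(** Minimality is tested at [t y + (1 - t) x]: convexity bounds [f] there and the quadratic term
    costs only [t^2], so dividing by [t] and letting it tend to 0 leaves the subgradient
    inequality. *)
Lemma prox_subgradient (gamma : K) f w x :
  Defs.proper f -> convex_ext f -> 0 < gamma -> prox gamma f w x ->
  subdifferential f x (gamma^-1 *: (w - x)).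
Proof.
move=> [fNy [y0 fy0]] cf g0 px.
have fx : f x \is a fin_num.
  rewrite fin_numE fNy/=; apply/eqP => fx; have := px y0.
  rewrite fx gt0_muley ?lte_fin// addye// leye_eq => /eqP h.
  have : f y0 \is a fin_num by rewrite fin_numE fNy/= lt_eqF.
  by move=> /fineK e; move: h; rewrite -e -EFinM -EFinD.
move=> y; have [fy|fy] := boolP (f y \is a fin_num); last first.
  move: fy; rewrite fin_numE fNy/= negbK => /eqP ->; exact: leey.
rewrite -[f x]fineK// -[f y]fineK// -EFinD lee_fin dotZl.
set a := fine (f x); set b := fine (f y).
rewrite -(ler_pM2l g0) mulrDr mulrA divff ?gt_eqF// mul1r.
have key t : 0 < t <= 1 ->
    gamma * a + dot (w - x) (y - x) <= gamma * b + t * (dot (y - x) (y - x) /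
      2).
  move=> /andP[t0 t1].
  have := px (t *: y + (1 - t) *: x); have := cf y x t; rewrite (ltW t0) t1.
  move=> /(_ isT); rewrite -[f x]fineK// -[f y]fineK// -!EFinM -EFinD -/a -/b.
  set fz := f _ => hz.
  have fz_fin : fz \is a fin_num.
    rewrite fin_numE fNy/=; apply/eqP => e.
    by move: hz; rewrite e leye_eq.
  move: hz; rewrite -[fz]fineK// -!EFinM -!EFinD !lee_fin; set c := fine fz.
  move=> h1; rewrite !sqr_enorm => h2.
  have E : t *: y + (1 - t) *: x - w = t *: (y - x) - (w - x).
    by apply/rowP => i; rewrite !mxE; ring.
  move: h2; rewrite E -[x - w]opprB.
  clear E; set p := y - x; set q := w - x; clearbody p q.
  rewrite !dot_lin (dotC p q).
  have h3 := ler_wpM2l (ltW g0) h1.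
  move=> h2; rewrite -(ler_pM2l t0).
  set u := dot p p in h2 *; set v := dot q q in h2 *; set s := dot q p in h2 *.
  lra.
rewrite leNgt; apply/negP => lt.
set D := dot (y - x) (y - x) / 2 in key; have D0 : 0 <= D.
  by rewrite divr_ge0// dot_ge0.
set e := gamma * a + dot (w - x) (y - x) - gamma * b.
have e0 : 0 < e by rewrite /e; lra.
have D1 : 0 < e + D + 1 by lra.
(* This [t] is at most 1 and satisfies [t D < e]. *)
have t01 : 0 < e / (e + D + 1) <= 1.
  by rewrite divr_gt0//= ler_pdivrMr//; lra.
have := key _ t01; rewrite -lerBlDl -/e mulrAC ler_pdivlMr//; nra.
Qed.

Lemma subgradient_prox (gamma : K) f w x :
  Defs.proper f -> 0 < gamma -> subdifferential f x (gamma^-1 *: (w - x)) ->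
  prox gamma f w x.
Proof.
move=> pf g0 gx y; have fx := subgradient_fin_num pf gx.
have [fy|fy] := boolP (f y \is a fin_num); last first.
  move: fy; rewrite fin_numE pf.1/= negbK => /eqP ->.
  by rewrite gt0_muley ?lte_fin// addye// leey.
have := subgradient_fine fx fy gx.
rewrite -(ler_pM2l g0) dotZl mulrDr mulVKf ?gt_eqF//.
rewrite -[f x]fineK// -[f y]fineK// -!EFinM -!EFinD !lee_fin /= !sqr_enorm.
have -> : y - w = (y - x) + (x - w) by rewrite subrKA.
have := dot_ge0 (y - x).
rewrite -[w - x]opprB; set p := y - x; set q := x - w; clearbody p q.
rewrite !dot_lin (dotC p q); lra.
Qed.

Lemma prox_nonexpansive (gamma : K) f w w' x x' :
  Defs.proper f -> convex_ext f -> 0 < gamma -> prox gamma f w x ->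
  prox gamma f w' x' -> enorm (x - x') <= enorm (w - w').
Proof.
move=> pf cf g0 px px'.
have gx := prox_subgradient pf cf g0 px.
have gx' := prox_subgradient pf cf g0 px'.
have := subdifferential_monotone pf gx gx'.
rewrite -scalerBr dotZl pmulr_rge0 ?invr_gt0//.
have -> : w - x - (w' - x') = (w - w') - (x - x').
  by apply/rowP => i; rewrite !mxE; ring.
rewrite dotBl subr_ge0 -sqr_enorm => h.
have := le_trans h (le_trans (ler_norm _) (dot_le_enorm _ _)).
have := enorm_ge0 (x - x'); have := enorm_ge0 (w - w').
set a := enorm _; set b := enorm _ => a0 b0 ab.
rewrite leNgt; apply/negP => ba.
have : 0 < b * (b - a) by rewrite mulr_gt0 ?subr_gt0//; apply: le_lt_trans ba.
lra.
Qed.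

Lemma subdifferential_sum_Argmin f1 f2 x g : Defs.proper f1 -> Defs.proper f2 ->
  subdifferential f1 x g -> subdifferential f2 x (- g) ->
  Argmin (f1 \+ f2)%E x.
Proof.
move=> p1 p2 g1 g2 y /=.
have := leeD (g1 y) (g2 y); have f1x := subgradient_fin_num p1 g1.
have f2x := subgradient_fin_num p2 g2.
rewrite -[f1 x]fineK// -[f2 x]fineK// -!EFinD dotNl.
by rewrite addrACA subrr addr0.
Qed.

End Proximal.

(** * Generalized symmetric eigenvalue problems *)

Section Continuity.
Context {K : realType} {V W : normedModType K}.

Lemma continuous_normr (f : V -> W) x :
  {for x, continuous f} -> {for x, continuous (fun y => `|f y| : K)}.
Proof. exact: cvg_norm. Qed.

Lemma continuous_div (f g : V -> K) x : g x != 0 ->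
  {for x, continuous f} -> {for x, continuous g} ->
  {for x, continuous (fun y => f y / g y)}.
Proof. by move=> g0 cf cg; apply: cvgM => //; exact: cvgV. Qed.

End Continuity.

Section GeneralizedEigenvalues.
Context {K : realType} {n : nat}.
Variables (P M : 'M[K]_n).
Hypotheses (Psym : P^T = P) (Ppd : forall x : 'rV[K]_n, x != 0 -> 0 < dot (x *m
  P) x).
Hypothesis MPsym : (M *m P)^T = M *m P.

Local Notation A := (M *m P).

Lemma pd_psd : psd P.
Proof.
by move=> x; have [->|/Ppd/ltW//] := eqVneq x 0; rewrite mul0mx dot0l.
Qed.

Lemma complex_Re_sum I (r : seq I) (F : I -> complex K) :
  complex.Re (\sum_(i <- r) F i) = \sum_(i <- r) complex.Re (F i).
Proof. by apply: (big_morph (@complex.Re K)) => // -[a b] [c d]. Qed.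

Lemma complex_Im_sum I (r : seq I) (F : I -> complex K) :
  complex.Im (\sum_(i <- r) F i) = \sum_(i <- r) complex.Im (F i).
Proof. by apply: (big_morph (@complex.Im K)) => // -[a b] [c d]. Qed.

(** For [v = v1 + i v2] and the eigenvalue [a + i b], symmetry of [M P] on the pair [v1], [v2] reads
    [b (<v1 P, v1> + <v2 P, v2>) = 0]. *)
Lemma real_spectrum_symmetric : real_spectrum M.
Proof.
move=> [a b] /eigenvalueP[v vM v0]; rewrite complex_real.
pose v1 : 'rV[K]_n := map_mx (@complex.Re K) v.
pose v2 : 'rV[K]_n := map_mx (@complex.Im K) v.
have e1 : v1 *m M = a *: v1 - b *: v2.
  apply/rowP => i; have /rowP/(_ i) := vM; rewrite !mxE => /(congr1
    (@complex.Re K)).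
  rewrite complex_Re_sum => E; transitivity (complex.Re (Complex a b * v 0 i)).
    rewrite -E; apply: eq_bigr => j _; rewrite !mxE.
    by case: (v 0 j) => c d /=; rewrite mulr0 subr0.
  by case: (v 0 i).
have e2 : v2 *m M = b *: v1 + a *: v2.
  apply/rowP => i; have /rowP/(_ i) := vM; rewrite !mxE => /(congr1
    (@complex.Im K)).
  rewrite complex_Im_sum => E; transitivity (complex.Im (Complex a b * v 0 i)).
    rewrite -E; apply: eq_bigr => j _; rewrite !mxE.
    by case: (v 0 j) => c d /=; rewrite mulr0 add0r.
  by case: (v 0 i) => c d /=; rewrite addrC.
have : dot (v1 *m A) v2 = dot (v2 *m A) v1 by rewrite dot_mulmxl MPsym dotC.
have PC : dot (v2 *m P) v1 = dot (v1 *m P) v2 by rewrite dot_mulmxl Psym dotC.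
rewrite !mulmxA e1 e2 !(mulmxDl, mulNmx) -!scalemxAl !dot_lin PC => E.
have : b * (dot (v1 *m P) v1 + dot (v2 *m P) v2) = 0 by lra.
move=> /eqP; rewrite mulf_eq0 => /orP[//|] /eqP s0.
have p1 := pd_psd v1; have p2 := pd_psd v2.
case/eqP: v0; apply/rowP => i; rewrite mxE.
have /eqP z1 : v1 == 0.
  by apply/negPn/negP => /Ppd; lra.
have /eqP z2 : v2 == 0.
  by apply/negPn/negP => /Ppd; lra.
have /rowP/(_ i) := z1; have /rowP/(_ i) := z2.
by rewrite !mxE; case: (v 0 i) => c d /= -> ->.
Qed.

Lemma continuous_quadratic_form (B : 'M[K]_n) x :
  {for x, continuous (fun y : 'rV[K]_n => dot (y *m B) y : K^o)}.
Proof.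
have s1 := strict_mulmx B x; have s2 := strict_mulmx 1%:M x.
have [d d0 H] := strict_dot s1 s2 ltr01.
set s := _ *m _^T + _ in H; have [k k0 Hk] := mulmx_bounded s.
apply/continuous_distP => e e0.
have k1 : 0 < 1 + k by rewrite addr_gt0.
exists (Num.min d (e / (1 + k))) => [|y]; first by rewrite lt_min d0 divr_gt0.
rewrite lt_min ltr_pdivlMr// => /andP[yd ye].
have := H y x yd; rewrite subrr normr0 => /(_ d0); rewrite !mulmx1 => h1.
have h2 := le_trans (norm_coord ((y - x) *m s) 0) (Hk _).
set u := dot _ _ - _ in h1 *; rewrite -[u](subrK (((y - x) *m s) 0 0)).
rewrite (le_trans (ler_normD _ _))//.
have := ltW ye; rewrite mulrDr mulr1; lra.
Qed.

Section Rayleigh.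
Variable C : 'M[K]_n.
Hypothesis C0 : exists e : 'rV[K]_n, e *m C != 0.
Hypothesis CM : forall e : 'rV[K]_n, exists e' : 'rV[K]_n, e *m C *m M = e' *m
  C.

(** With [C = 1] this gives the largest eigenvalue, with [C = lam - M] the largest one on the image
    of [C]. Where the quotient attains its maximum [mu] on that image, the semidefinite form
    [mu P - A] vanishes, so by Cauchy-Schwarz [mu x0 - x0 M] is [P]-orthogonal to the image. By
    invariance it lies in the image, hence is 0. *)
Lemma Rayleigh_eigenvector : exists (mu : K) (e0 : 'rV[K]_n),
  [/\ e0 *m C != 0, e0 *m C *m M = mu *: (e0 *m C) &
      forall e : 'rV[K]_n, dot (e *m C *m A) (e *m C) <= mu * dot (e *m C *m P)
        (e *m C)].
Proof.
(* The image of [C] is written as a kernel, which makes it visibly closed. *)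
pose S := [set x : 'rV[K]_n | `|x| = 1] `&` [set x | x *m cokermx C = 0].
have S_im x : S x -> exists e, x = e *m C.
  by move=> [_ /eqP]; rewrite -submxE => /submxP.
have S_ne x : S x -> x != 0.
  by move=> [x1 _]; rewrite -normr_eq0 x1 oner_eq0.
have S_of e : e *m C != 0 -> S (`|e *m C|^-1 *: (e *m C)).
  move=> eC; split=> /=; first by rewrite normrZ normfV normr_id mulVf//
    normr_eq0.
  by apply/eqP; rewrite -submxE scalemxAl submxMl.
have Sc : compact S.
  apply: bounded_closed_compact.
    by exists 1; split; [exact: num_real|move=> y y1 x [/= -> _]; exact: ltW].
  apply: closedI.
    apply: (@preimage_closed _ _ (fun x : 'rV[K]_n => `|x| : K) [set 1]).
      by move=> x _; exact: norm_continuous.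
    exact: closed_eq.
  have -> : [set x : 'rV[K]_n | x *m cokermx C = 0] =
      (fun x => `|x *m cokermx C| : K) @^-1` [set 0].
    by apply/seteqP; split=> x /=; [move=> ->; rewrite normr0|move/normr0_eq0].
  apply: preimage_closed; last exact: closed_eq.
  move=> x _.
  exact: (continuous_normr (strict_continuous (strict_mulmx (cokermx C) x))).
pose r (x : 'rV[K]_n) : K := dot (x *m A) x / dot (x *m P) x.
have Sne : S !=set0.
  by case: C0 => e /S_of; exists (`|e *m C|^-1 *: (e *m C)).
have rc : {within S, continuous r}.
  apply: continuous_in_subspaceT => x; rewrite inE => xS.
  have x0 : dot (x *m P) x != 0 by rewrite gt_eqF// Ppd// S_ne.
  have h1 := @continuous_quadratic_form A x.
  have h2 := @continuous_quadratic_form P x.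
  exact: (@continuous_div K _ (fun y => dot (y *m A) y)
            (fun y => dot (y *m P) y) x x0 h1 h2).
have [x0 xS xmax] := EVT_max_rV Sne Sc rc.
rewrite inE in xS; have [e0 xe] := S_im _ xS.
exists (r x0), e0; rewrite -xe; have x00 := S_ne _ xS.
have max_e e : dot (e *m C *m A) (e *m C) <= r x0 * dot (e *m C *m P) (e *m C).
  have [->|eC] := eqVneq (e *m C) 0; first by rewrite !mul0mx !dot0l mulr0.
  have := S_of _ eC; set y := _ *: _ => yS; have := xmax y.
  rewrite inE => /(_ yS); rewrite {1}/r ler_pdivrMr ?Ppd ?S_ne//.
  have i0 : 0 < `|e *m C|^-1 by rewrite invr_gt0 normr_gt0.
  rewrite /y -!scalemxAl !dotZl !dotZr !(mulrCA (r x0)).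
  by rewrite !(ler_pM2l i0).
split=> //.
pose D := C *m (r x0 *: P - A) *m C^T.
have DE e e' : dot (e *m D) e' = dot (e *m C *m (r x0 *: P - A)) (e' *m C).
  by rewrite /D !mulmxA dot_mulmxl trmxK.
have Dsym : D^T = D.
  by rewrite /D !trmx_mul trmxK linearB linearZ/= Psym MPsym mulmxA.
have Dpsd : psd D.
  move=> e; rewrite DE mulmxBr dotBl -scalemxAr dotZl subr_ge0; exact: max_e.
have [e' Ee'] := CM e0; rewrite -xe in Ee'.
have h0 : dot (x0 *m (r x0 *: P - A)) x0 = 0.
  by rewrite mulmxBr dotBl -scalemxAr dotZl /r divfK ?subrr// gt_eqF// Ppd.
have := psd_CauchySchwarz e0 (r x0 *: e0 - e') Dsym Dpsd.
rewrite !DE -xe h0 mul0r => h.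
have : dot (x0 *m (r x0 *: P - A)) ((r x0 *: e0 - e') *m C) == 0.
  by rewrite -sqrf_eq0 eq_le h sqr_ge0.
rewrite mulmxBl -scalemxAl -xe -Ee'.
have -> : x0 *m (r x0 *: P - A) = (r x0 *: x0 - x0 *m M) *m P.
  by rewrite mulmxBr mulmxBl -scalemxAr -scalemxAl mulmxA.
move=> /eqP d0; apply/eqP; rewrite eq_sym -subr_eq0; apply/negPn/negP => /Ppd.
by rewrite d0 ltxx.
Qed.

End Rayleigh.

End GeneralizedEigenvalues.

Lemma injective_unitmx (F : fieldType) n (B : 'M[F]_n) :
  (forall x : 'rV_n, x *m B = 0 -> x = 0) -> B \in unitmx.
Proof.
move=> inj; rewrite -row_free_unit -kermx_eq0; apply/eqP/row_matrixP => i.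
by rewrite row0; apply: inj; apply/sub_kermxP; exact: row_sub.
Qed.

Lemma pd_unitmx (K : realType) n (B : 'M[K]_n) :
  (forall x : 'rV_n, x != 0 -> 0 < dot (x *m B) x) -> B \in unitmx.
Proof.
move=> Bpd; apply: injective_unitmx => x xB; apply/eqP/negPn/negP => /Bpd.
by rewrite xB dot0l ltxx.
Qed.

(** If [alpha < rho], the upper bound [alpha^j a_N] eventually falls below the lower bound
    [c rho^(N + j)]. This converts the assumed rate into spectral inequalities. *)
Lemma geometric_growth (K : realType) (a : nat -> K) (c rho alpha : K) N :
  0 < c -> 0 < rho ->
  (forall k, (N <= k)%N -> a k.+1 <= alpha * a k) ->
  (forall k, (N <= k)%N -> c * rho ^+ k <= a k) -> rho <= alpha.
Proof.
move=> c0 r0 aS ar; rewrite leNgt; apply/negP => lt.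
have a_gt0 k : (N <= k)%N -> 0 < a k.
  by move=> /ar; apply: lt_le_trans; rewrite mulr_gt0// exprn_gt0.
have al0 : 0 < alpha.
  have := lt_le_trans (a_gt0 N.+1 (leqnSn N)) (aS N (leqnn N)).
  by rewrite pmulr_lgt0// a_gt0.
have aj j : a (N + j)%N <= alpha ^+ j * a N.
  elim: j => [|j IH]; first by rewrite addn0 expr0 mul1r.
  rewrite addnS (le_trans (aS _ (leq_addr _ _)))// exprS -mulrA.
  by rewrite ler_wpM2l// ltW.
have q1 : `|alpha / rho| < 1.
  by rewrite gtr0_norm ?divr_gt0// ltr_pdivrMr// mul1r.
have aN := a_gt0 N (leqnn N).
have e0 : 0 < c * rho ^+ N / a N by rewrite divr_gt0// mulr_gt0// exprn_gt0.
have /cvgrPdist_lt/(_ _ e0)[j _ /(_ j (leqnn j))] := cvg_expr q1.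
rewrite /= sub0r normrN normrX gtr0_norm ?divr_gt0// ltr_pdivlMr//.
rewrite expr_div_n mulrAC ltr_pdivrMr ?exprn_gt0//.
rewrite -mulrA -exprD ltNge => /negP; apply.
exact: le_trans (ar _ (leq_addr _ _)) (aj j).
Qed.

(** * Perturbed linear recursions align with the dominant eigenspace *)

Section DominantEigenvalue.
Context {K : realType} {n : nat}.
Variables (P M : 'M[K]_n).
Hypotheses (Psym : P^T = P) (Ppd : forall x : 'rV[K]_n, x != 0 -> 0 < dot (x *m
  P) x).
Hypotheses (MPsym : (M *m P)^T = M *m P) (MPpsd : psd (M *m P)).

Definition form_norm x := Num.sqrt (dot (x *m P) x).
Local Notation pnorm := form_norm.
Local Notation Ppsd := (pd_psd Ppd).

Lemma sqr_pnorm x : pnorm x ^+ 2 = dot (x *m P) x.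
Proof. by rewrite sqr_sqrtr// Ppsd. Qed.

Lemma pnorm_ge0 x : 0 <= pnorm x.
Proof. exact: sqrtr_ge0. Qed.

Lemma pnormD x y : pnorm (x + y) <= pnorm x + pnorm y.
Proof.
rewrite -(@ler_pXn2r _ 2)// ?nnegrE ?addr_ge0 ?pnorm_ge0//.
rewrite sqrrD !sqr_pnorm mulmxDl !dot_lin.
have -> : dot (y *m P) x = dot (x *m P) y by rewrite dot_mulmxl Psym dotC.
have : `|dot (x *m P) y| <= pnorm x * pnorm y.
  rewrite -(@ler_pXn2r _ 2)// ?nnegrE ?mulr_ge0 ?pnorm_ge0//.
  rewrite exprMn !sqr_pnorm -normrX ger0_norm ?sqr_ge0//.
  exact: (psd_CauchySchwarz _ _ Psym Ppsd).
move=> /(le_trans (ler_norm _)); lra.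
Qed.

Lemma pnormZ a x : pnorm (a *: x) = `|a| * pnorm x.
Proof.
by rewrite /form_norm -scalemxAl dotZl dotZr mulrA -expr2 sqrtrM ?sqr_ge0//
  sqrtr_sqr.
Qed.

Lemma pnormN x : pnorm (- x) = pnorm x.
Proof. by rewrite -scaleN1r pnormZ normrN1 mul1r. Qed.

Lemma pnorm_le_norm : exists2 k : K, 0 < k & forall x, pnorm x <= k * `|x|.
Proof.
have [k k0 H] := mulmx_bounded P.
have nk : 0 <= n%:R * k by rewrite mulr_ge0// ltW.
exists (1 + n%:R * k) => [|x]; first by rewrite ltr_pwDl.
rewrite -(@ler_pXn2r _ 2)// ?nnegrE ?mulr_ge0 ?pnorm_ge0 ?addr_ge0//.
rewrite sqr_pnorm (le_trans (ler_norm _))// (le_trans (norm_dot_le _ _))//.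
apply: le_trans (ler_wpM2l (ler0n _ n) (ler_wpM2r (normr_ge0 x) (H x))) _.
rewrite exprMn [`|x| ^+ 2]expr2 [leLHS](_ : _ = n%:R * k * (`|x| * `|x|)).
  by rewrite ler_wpM2r ?mulr_ge0//; nra.
by ring.
Qed.

(** [<x, x> = <x P, x P^-1>] is at most the product of the [P]-norms of [x] and [x P^-1], and the
    latter is bounded by a multiple of [|x|]. *)
Lemma norm_le_pnorm : exists2 k : K, 0 < k & forall x, `|x| <= k * pnorm x.
Proof.
have Pu := pd_unitmx Ppd.
have [k k0 H] := mulmx_bounded (invmx P); have [l l0 L] := pnorm_le_norm.
have kl : 0 < l * k by rewrite mulr_gt0.
exists (l * k) => // x.
have h : dot x x <= pnorm x * pnorm (x *m invmx P).
  have -> : dot x x = dot (x *m P) (x *m invmx P).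
    by rewrite dot_mulmxl Psym -mulmxA mulVmx// mulmx1.
  rewrite (le_trans (ler_norm _))//.
  rewrite -(@ler_pXn2r _ 2)// ?nnegrE ?mulr_ge0 ?pnorm_ge0//.
  rewrite exprMn !sqr_pnorm -normrX ger0_norm ?sqr_ge0//.
  exact: (psd_CauchySchwarz _ _ Psym Ppsd).
have h2 : `|x| ^+ 2 <= dot x x.
  by rewrite -sqr_enorm ler_pXn2r ?nnegrE ?enorm_ge0// norm_le_enorm.
have [x0|x0] := eqVneq `|x| 0; first by rewrite x0 mulr_ge0 ?pnorm_ge0 ?ltW.
have x_gt0 : 0 < `|x| by rewrite lt_def x0 normr_ge0.
rewrite -(ler_pM2r x_gt0) -expr2 (le_trans (le_trans h2 h))//.
rewrite [leRHS](_ : _ = pnorm x * (l * (k * `|x|))); last by rewrite /=; ring.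
rewrite ler_wpM2l ?pnorm_ge0// (le_trans (L _))// ler_wpM2l ?(ltW l0)//.
Qed.

(** With [x] in the image of [C] and [y = x M], Cauchy-Schwarz for the semidefinite form [M P]
    bounds the fourth power of the [P]-norm of [y] by [<x M P, x> <y M P, y>]; invariance makes the
    Rayleigh bound available for [y] too. *)
Lemma pnorm_Rayleigh C (mu : K) : 0 <= mu ->
  (forall e : 'rV[K]_n, exists e' : 'rV[K]_n, e *m C *m M = e' *m C) ->
  (forall e : 'rV[K]_n,
     dot (e *m C *m (M *m P)) (e *m C) <= mu * dot (e *m C *m P) (e *m C)) ->
  forall e : 'rV[K]_n, pnorm (e *m C *m M) <= mu * pnorm (e *m C).
Proof.
move=> mu0 CM H e; have [e' E] := CM e.
have := psd_CauchySchwarz (e *m C) (e *m C *m M) MPsym MPpsd.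
have -> : dot (e *m C *m (M *m P)) (e *m C *m M) = pnorm (e *m C *m M) ^+ 2.
  by rewrite sqr_pnorm mulmxA.
have h1 := H e; have h2 := H e'; rewrite -E in h2.
rewrite -!sqr_pnorm in h1 h2.
have := MPpsd (e *m C *m M); have := MPpsd (e *m C).
set a := dot _ _ in h1 *; set b := dot _ _ in h2 *.
have := pnorm_ge0 (e *m C *m M).
have := pnorm_ge0 (e *m C).
set p := pnorm (e *m C) in h1 *; set q := pnorm _ in h2 *.
move=> p0 q0 a0 b0 h.
have {}h : q ^+ 2 * q ^+ 2 <= (mu * p) ^+ 2 * q ^+ 2.
  rewrite -expr2 (le_trans h)// (le_trans (ler_pM a0 b0 h1 h2))//.
  by rewrite le_eqVlt; apply/orP; left; apply/eqP; ring.
have [->|qn] := eqVneq q 0; first by rewrite mulr_ge0.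
have q2 : 0 < q ^+ 2 by rewrite exprn_gt0// lt_def qn.
move: h; rewrite ler_pM2r// ler_pXn2r// nnegrE mulr_ge0//.
Qed.

Lemma eigenvalue_ge0 (a : K) : eigenvalue M a -> 0 <= a.
Proof.
move=> /eigenvalueP[v vM /Ppd v0]; have := MPpsd v.
by rewrite mulmxA vM -scalemxAl dotZl pmulr_lge0.
Qed.

(** Eigenvalues are nonnegative and the supremum of a set without one is 0; hence a rate above this
    value is positive, however many eigenvalues there are. *)
Lemma second_largest_eigenvalue_ge0 : 0 <= second_largest_eigenvalue M.
Proof.
rewrite /second_largest_eigenvalue; set S := [set _ | _].
have [[a Sa]|/set0P/negP/negPn/eqP->] := pselect (S !=set0); last by rewrite
  sup0.
have [hs|/sup_out -> //] := pselect (has_sup S).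
have /(_ _ Sa) := sup_upper_bound hs; apply: le_trans.
by apply: eigenvalue_ge0; case: Sa.
Qed.

Lemma dominant_eigenvalue (e : nat -> 'rV[K]_n) (c rho : K) :
  (forall eps : K, 0 < eps -> \forall k \near \oo,
    `|e k.+1 - e k *m M| <= eps * `|e k|) ->
  0 < c -> (\forall k \near \oo, c * rho ^+ k <= `|e k|) ->
  second_largest_eigenvalue M < rho ->
  exists2 lam : K, 0 < lam & forall eps : K, 0 < eps -> \forall k \near \oo,
    `|e k.+1 - lam *: e k| <= eps * `|e k|.
Proof.
move=> eM c0 ce srho.
have rho0 : 0 < rho := le_lt_trans second_largest_eigenvalue_ge0 srho.
have [k1 k10 Hk1] := pnorm_le_norm; have [k2 k20 Hk2] := norm_le_pnorm.
have peM eps : 0 < eps -> \forall k \near \oo,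
    pnorm (e k.+1 - e k *m M) <= eps * pnorm (e k).
  move=> eps0; have e1 : 0 < eps / (k1 * k2) by rewrite divr_gt0// mulr_gt0.
  apply: filterS (eM _ e1) => k h.
  rewrite (le_trans (Hk1 _))// (le_trans (ler_wpM2l (ltW k10) h))//.
  rewrite (le_trans (ler_wpM2l (ltW k10) (ler_wpM2l (ltW e1) (Hk2 _))))//.
  rewrite le_eqVlt; apply/orP; left; apply/eqP; field.
  by rewrite !gt_eqF.
have [N0 _ HN0] := ce.
have pe k : (N0 <= k)%N -> c / k2 * rho ^+ k <= pnorm (e k).
  move=> /HN0 h; rewrite mulrAC ler_pdivrMr// mulrC.
  by rewrite mulrC (le_trans h)// mulrC.
have e_neq0 : e N0 != 0.
  rewrite -normr_gt0 (lt_le_trans _ (HN0 _ (leqnn _)))// mulr_gt0//.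
  by rewrite exprn_gt0.
have C1 : exists x : 'rV[K]_n, x *m 1%:M != 0 by exists (e N0); rewrite mulmx1.
have CM1 (x : 'rV[K]_n) : exists x' : 'rV[K]_n, x *m 1%:M *m M = x' *m 1%:M.
  by exists (x *m M); rewrite !mulmx1.
have [lam [v [v0 vM lam_max]]] := Rayleigh_eigenvector Psym Ppd MPsym C1 CM1.
rewrite mulmx1 in v0; rewrite mulmx1 in vM.
have lam_max' x : dot (x *m (M *m P)) x <= lam * dot (x *m P) x.
  by have := lam_max x; rewrite mulmx1.
have lam_eig : eigenvalue M lam by apply/eigenvalueP; exists v.
have lam_ge0 := eigenvalue_ge0 lam_eig.
have lam_norm x : pnorm (x *m M) <= lam * pnorm x.
  by have := pnorm_Rayleigh lam_ge0 CM1 lam_max x; rewrite !mulmx1.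
(* Otherwise the increments, multiplied by at most [lam + eps] at each step, would decay faster than
   [rho^k]. *)
have rho_lam : rho <= lam.
  apply/ler_addgt0Pr => eps eps0; have [N _ HN] := peM _ eps0.
  apply: (@geometric_growth _ (fun k => pnorm (e k)) (c / k2) rho _ (maxn N
    N0)) => //.
  - by rewrite divr_gt0.
  - move=> k; rewrite geq_max => /andP[/HN h _].
    rewrite -[e k.+1](subrK (e k *m M)) (le_trans (pnormD _ _))// mulrDl addrC.
    by rewrite lerD.
  - by move=> k; rewrite geq_max => /andP[_ /pe].
have lam0 : 0 < lam := lt_le_trans rho0 rho_lam.
exists lam => //.
pose C : 'M[K]_n := lam%:M - M.
have CE x : x *m C = lam *: x - x *m M by rewrite mulmxBr mul_mx_scalar.
have CM x : x *m C *m M = x *m M *m C.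
  by rewrite !CE mulmxBl -scalemxAl.
suff main : forall d : K, 0 < d -> \forall k \near \oo,
    pnorm (e k *m C) <= d * pnorm (e k).
  move=> eps eps0.
  have e2 : 0 < eps / 2 by rewrite divr_gt0.
  have e3 : 0 < eps / 2 / (k1 * k2) by rewrite divr_gt0// mulr_gt0.
  apply: filterS2 (eM _ e2) (main _ e3) => k h1 h2.
  have -> : e k.+1 - lam *: e k = (e k.+1 - e k *m M) - e k *m C.
    by rewrite CE opprB addrA subrK.
  rewrite (le_trans (ler_normB _ _))//.
  have : `|e k *m C| <= eps / 2 * `|e k|.
    rewrite (le_trans (Hk2 _))// (le_trans (ler_wpM2l (ltW k20) h2))//.
    rewrite (le_trans (ler_wpM2l (ltW k20) (ler_wpM2l (ltW e3) (Hk1 _))))//.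
    rewrite le_eqVlt; apply/orP; left; apply/eqP; field.
    by rewrite !gt_eqF.
  lra.
have [C0|C0] := pselect (exists x : 'rV[K]_n, x *m C != 0); last first.
  move=> d d0; near=> k.
  have -> : e k *m C = 0 by apply/eqP/negPn/negP => h; apply: C0; exists (e k).
  by rewrite /form_norm mul0mx dot0l sqrtr0 mulr_ge0 ?pnorm_ge0 ?ltW.
have CM' (x : 'rV[K]_n) : exists x' : 'rV[K]_n, x *m C *m M = x' *m C.
  by exists (x *m M).
have [mu [w0 [w_neq0 wM mu_max]]] := Rayleigh_eigenvector Psym Ppd MPsym C0 CM'.
have mu_eig : eigenvalue M mu by apply/eigenvalueP; exists (w0 *m C).
have mu_ge0 := eigenvalue_ge0 mu_eig.
have mu_norm := pnorm_Rayleigh mu_ge0 CM' mu_max.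
have eig_le (a : K) : eigenvalue M a -> a <= lam.
  move=> /eigenvalueP[x xM /Ppd x0]; have := lam_max' x.
  by rewrite mulmxA xM -scalemxAl dotZl ler_pM2r.
(* A [lam]-eigenvector in the image of [C = lam - M] would be [P]-orthogonal to itself, as [C] is
   self-adjoint and kills it. *)
have mu_lam : mu < lam.
  rewrite lt_neqAle eig_le// andbT; apply/negP => /eqP mul.
  have wC : w0 *m C *m C = 0 by rewrite CE wM mul subrr.
  have CP : (C *m P)^T = C *m P.
    by rewrite mulmxBl linearB/= MPsym mul_scalar_mx linearZ/= Psym.
  have /Ppd := w_neq0.
  by rewrite -mulmxA dot_mulmxl CP mulmxA wC mul0mx dot0r ltxx.
(* [mu] is exceeded by the eigenvalue [lam], so it belongs to the set whose supremum is
   [second_largest_eigenvalue M]. *)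
have mu_rho : mu < rho.
  apply: le_lt_trans srho; rewrite /second_largest_eigenvalue.
  apply: sup_upper_bound; last by split=> //; exists lam.
  split; first by exists mu; split=> //; exists lam.
  by exists lam => a [/eig_le].
have [k3 k30 Hk3] : exists2 k : K, 0 < k & forall x, pnorm (x *m C) <= k *
  pnorm x.
  have [l l0 L] := mulmx_bounded C.
  exists (k1 * (l * k2)) => [|x]; first by rewrite !mulr_gt0.
  rewrite (le_trans (Hk1 _))// -mulrA ler_wpM2l ?(ltW k10)//.
  by rewrite (le_trans (L _))// -mulrA ler_wpM2l ?(ltW l0).
pose g := rho - mu; have g0 : 0 < g by rewrite subr_gt0.
have gE : rho = g + mu by rewrite /g subrK.
clearbody g.
(* Narrow cones suffice: with [d <= g / 4], inside the cone the [P]-norm of [e k] is multiplied by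
   at least [mu + g / 2]. *)
suff small d : 0 < d -> d <= g / 4 -> \forall k \near \oo,
    pnorm (e k *m C) <= d * pnorm (e k).
  move=> d d0; have m0 : 0 < Num.min d (g / 4) by rewrite lt_min d0 divr_gt0.
  have mg : Num.min d (g / 4) <= g / 4 by rewrite ge_min lexx orbT.
  apply: filterS (small _ m0 mg) => k h; rewrite (le_trans h)//.
  by rewrite ler_wpM2r ?pnorm_ge0// ge_min lexx.
move=> d0 dg.
(* [eps <= g / 4] protects this growth of [e k]; [eps <= d (g / 4)] keeps the next transversal part
   below [d (mu + g / 4)] times the norm of [e k], so the cone is never left. *)
pose eps := Num.min (g / 4) (d * (g / 4)).
have eps0 : 0 < eps by rewrite lt_min !divr_gt0//= mulr_gt0// divr_gt0.
have eps1 : eps <= g / 4 by rewrite ge_min lexx.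
have eps2 : eps <= d * (g / 4) by rewrite ge_min lexx orbT.
clearbody eps; have eps3 : 0 < eps / (1 + k3) by rewrite divr_gt0// addr_gt0.
have eps4 : k3 * (eps / (1 + k3)) <= eps.
  by rewrite mulrCA ger_pMr// ler_pdivrMr ?addr_gt0// mul1r lerDr.
have eps5 : eps / (1 + k3) <= eps.
  have k31 : 0 < 1 + k3 by rewrite addr_gt0.
  rewrite ler_pdivrMr// mulrDr mulr1 lerDl mulr_ge0//; exact: ltW.
have [N _ HN] := peM _ eps3.
have step1 k : (N <= k)%N ->
    pnorm (e k.+1 *m C) <= mu * pnorm (e k *m C) + eps * pnorm (e k).
  move=> /HN h.
  have -> : e k.+1 *m C = e k *m C *m M + (e k.+1 - e k *m M) *m C.
    by rewrite mulmxBl CM addrC subrK.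
  apply: le_trans (pnormD _ _) (lerD (mu_norm _) _).
  apply: le_trans (Hk3 _) (le_trans (ler_wpM2l (ltW k30) h) _).
  by rewrite mulrA; have := ler_wpM2r (pnorm_ge0 (e k)) eps4.
have step2 k : (N <= k)%N ->
    lam * pnorm (e k) - pnorm (e k *m C) - eps * pnorm (e k) <= pnorm (e k.+1).
  move=> /HN h; rewrite -addrA -opprD lerBlDr.
  have -> : lam * pnorm (e k) = pnorm (lam *: e k) by rewrite pnormZ ger0_norm.
  have -> : lam *: e k = e k.+1 + (e k *m C - (e k.+1 - e k *m M)).
    by rewrite CE opprB subrKA addrC subrK.
  apply: le_trans (pnormD _ _) (lerD (lexx _) _).
  apply: le_trans (pnormD _ _) (lerD (lexx _) _).
  by rewrite pnormN (le_trans h)//; have := ler_wpM2r (pnorm_ge0 (e k)) eps5.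
have stay k : (N <= k)%N -> pnorm (e k *m C) <= d * pnorm (e k) ->
    pnorm (e k.+1 *m C) <= d * pnorm (e k.+1).
  move=> Nk h; have h1 := step1 _ Nk; have h2 := step2 _ Nk.
  have ek := pnorm_ge0 (e k).
  apply: le_trans h1 (le_trans _ (ler_wpM2l (ltW d0) h2)).
  set p := pnorm (e k) in h *; set q := pnorm (e k *m C) in h *.
  have i1 := ler_wpM2l mu_ge0 h; have i2 := ler_wpM2l (ltW d0) h.
  have i3 := ler_wpM2r ek eps2.
  have i4 := ler_wpM2l (ltW d0) (ler_wpM2r ek eps1).
  have i5 := ler_wpM2l (ltW d0) (ler_wpM2r ek rho_lam).
  have i6 := ler_wpM2l (ltW d0) (ler_wpM2r ek dg).
  rewrite -/p in ek i1 i2 i3 i4 i5 i6.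
  rewrite gE in i5; clearbody p q.
  have i7 : 0 <= d * (g * p) by rewrite !mulr_ge0// ltW.
  lra.
have [[K0 NK0 HK0]|no] := pselect (exists2 k, (maxn N N0 <= k)%N &
    pnorm (e k *m C) <= d * pnorm (e k)).
  exists K0 => // k; elim: k => [|k IH] /=.
    by rewrite leqn0 => /eqP K00; rewrite K00 in HK0.
  rewrite leq_eqVlt => /orP[/eqP <-//|]; rewrite ltnS => K0k.
  apply: stay (IH K0k); rewrite (leq_trans _ K0k)//.
  by move: NK0; rewrite geq_max => /andP[].
(* Outside the cone the norm of [e k] is at most that of [e k *m C] divided by [d], so [e k *m C]
   shrinks by [mu + g / 4 < rho] per step, yet stays above a multiple of [rho^k]. *)
exfalso.
have big k : (maxn N N0 <= k)%N -> d * pnorm (e k) <= pnorm (e k *m C).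
  by move=> Nk; rewrite leNgt; apply/negP => /ltW h; apply: no; exists k.
have : rho <= mu + g / 4.
  apply: (@geometric_growth _ (fun k => pnorm (e k *m C)) (d * (c / k2)) rho _
    (maxn N N0)).
  - by rewrite mulr_gt0// divr_gt0.
  - by [].
  - move=> k /[dup] /big h; rewrite geq_max => /andP[/step1 h1 _].
    apply: le_trans h1 _; rewrite mulrDl lerD2l.
    apply: le_trans (ler_wpM2r (pnorm_ge0 _) eps2) _.
    have g4 : 0 <= g / 4 by rewrite divr_ge0// ltW.
    by rewrite mulrAC mulrC; have := ler_wpM2l g4 h.
  - move=> k /[dup] /big h; rewrite geq_max => /andP[_ /pe h1].
    by apply: le_trans h; rewrite -mulrA; have := ler_wpM2l (ltW d0) h1.
rewrite gE; lra.
Unshelve. all: by end_near. Qed.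

End DominantEigenvalue.

(** * The Douglas-Rachford matrix *)

Section OperatorNorm.
Context {K : realType} {n : nat}.
Implicit Types (H : 'M[K]_n) (x : 'rV[K]_n).

Lemma opnorm_has_sup H :
  has_sup [set enorm (x *m H^T) | x in [set x : 'rV[K]_n | enorm x <= 1]].
Proof.
split.
  by exists (enorm (0 *m H^T)), 0 => //=; rewrite /enorm dot0l sqrtr0.
have [k k0 kH] := mulmx_bounded H^T; exists (n%:R * k) => _ [x /= x1 <-].
rewrite (le_trans (enorm_le_norm _))// ler_wpM2l// (le_trans (kH _))//.
by rewrite ger_pMr// (le_trans (norm_le_enorm _)).
Qed.

Lemma opnorm_ge0 H : 0 <= opnorm H.
Proof.
have := opnorm_has_sup H => hs; apply: le_trans (enorm_ge0 (0 *m H^T)) _.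
by apply: (sup_upper_bound hs); exists 0 => //=; rewrite /enorm dot0l sqrtr0.
Qed.

Lemma opnorm_le H x : enorm (x *m H^T) <= opnorm H * enorm x.
Proof.
have hs := opnorm_has_sup H.
have [x0|x0] := eqVneq (enorm x) 0.
  have /eqP -> : x == 0 by rewrite -dot_eq0 -sqr_enorm x0 expr0n.
  by rewrite mul0mx /enorm dot0l sqrtr0 mulr0.
have x_gt0 : 0 < enorm x by rewrite lt_def x0 enorm_ge0.
have xE : enorm ((enorm x)^-1 *: x) <= 1.
  by rewrite enormZ gtr0_norm ?invr_gt0// mulVf.
rewrite -ler_pdivrMr// mulrC -[(enorm x)^-1]gtr0_norm ?invr_gt0// -enormZ.
by rewrite scalemxAl; apply: (sup_upper_bound hs); exists ((enorm x)^-1 *: x).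
Qed.

(** For [b = 0] the extended inverse is [+oo], which is the convention for a vanishing Hessian. *)
Lemma lt_inve_mul_lt1 (a b : K) : 0 <= b ->
  (a%:E < (b%:E)^-1)%E -> a * b < 1.
Proof.
move=> b0; have [->|bn] := eqVneq b 0; first by rewrite mulr0.
by rewrite inver (negbTE bn) lte_fin -[ltRHS]mul1r ltr_pdivlMr// lt_def bn.
Qed.

End OperatorNorm.

Section DouglasRachfordMatrix.
Context {K : realType} {n : nat}.
Variables (gamma : K) (H N : 'M[K]_n).
Hypotheses (gamma0 : 0 < gamma) (Hsym : H^T = H) (Hpsd : psd H).
Hypotheses (Nsym : N^T = N) (Nfirm : forall x : 'rV[K]_n, dot (x *m N) (x *m N)
  <= dot (x *m N) x).

Definition resolvent_mx : 'M[K]_n := invmx (1%:M + gamma *: H).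
Local Notation L := resolvent_mx.

Lemma resolvent_unit : 1%:M + gamma *: H \in unitmx.
Proof.
apply: pd_unitmx => x x0.
rewrite mulmxDr mulmx1 -scalemxAr dotDl dotZl ltr_wpDr ?dot_gt0//.
by rewrite mulr_ge0 ?Hpsd// ltW.
Qed.

Lemma resolvent_sym : L^T = L.
Proof. by rewrite trmx_inv linearD/= linearZ/= Hsym trmx1. Qed.

(** On rows, [dz + (2 dx - dz) L - dx] with [dx = dz N] is [dz] times the matrix in parentheses; the
    transpose returns to matrices acting on columns. *)
Definition DR_mx : 'M[K]_n := (1%:M + (2 *: N - 1%:M) *m L - N)^T.

(** The linearized reflected proximal map of [R], that is the Cayley transform
    [(1 - gamma H) (1 + gamma H)^-1]. *)
Definition reflection_mx : 'M[K]_n := 2 *: L - 1%:M.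
Local Notation P := reflection_mx.

Lemma reflection_sym : P^T = P.
Proof. by rewrite linearB/= linearZ/= resolvent_sym trmx1. Qed.

Lemma DR_mxE : DR_mx = 2^-1 *: (1%:M + P *m (2 *: N - 1%:M)).
Proof.
have -> : P *m (2 *: N - 1%:M) = 2 *: (L *m (2 *: N - 1%:M)) - (2 *: N - 1%:M).
  by rewrite /P mulmxBl mul1mx -scalemxAl.
have -> : DR_mx = 1%:M + L *m (2 *: N - 1%:M) - N.
  rewrite /DR_mx linearB linearD/= trmx_mul resolvent_sym linearB/= linearZ/=.
  by rewrite !trmx1 Nsym.
move: (L *m _) => G; apply/matrixP => i j; rewrite !mxE; lra.
Qed.

Hypothesis gammaH : gamma * opnorm H < 1.

(** Cauchy-Schwarz for the form [H] between [x] and [x H] gives [H^2 <= |H| H]; the restriction on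
    the step size turns this into [gamma H^2 <= H]. *)
Lemma hessian_cocoercive x :
  gamma * dot (x *m H) (x *m H) <= dot (x *m H) x.
Proof.
have := psd_CauchySchwarz x (x *m H) Hsym Hpsd.
set y := x *m H; set q := dot y x; set s := dot y y => CS.
have yH : dot (y *m H) y <= opnorm H * s.
  rewrite (le_trans (ler_norm _))// (le_trans (dot_le_enorm _ _))//.
  rewrite /s -sqr_enorm expr2 mulrA ler_wpM2r ?enorm_ge0//.
  by have := opnorm_le H y; rewrite Hsym.
have q0 : 0 <= q := Hpsd x.
have s0 : 0 <= s := dot_ge0 y.
have [sn|sn] := eqVneq s 0; first by rewrite sn mulr0.
have sgt : 0 < s by rewrite lt_def sn.
have h : s <= q * opnorm H.
  rewrite -(ler_pM2r sgt) -expr2 (le_trans CS)// -mulrA ler_wpM2l//.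
apply: le_trans (ler_wpM2l (ltW gamma0) h) _.
by rewrite mulrCA ler_piMr// ltW.
Qed.

(** Writing [x = w (1 + gamma H)] removes the inverse: quadratic inequalities on [P] become
    inequalities between [w] and [w H]. *)
Lemma resolvent_split (x : 'rV[K]_n) :
  exists2 w : 'rV[K]_n, x = w + gamma *: (w *m H) & x *m P = w - gamma *: (w *m
    H).
Proof.
have xE : x = x *m L + gamma *: (x *m L *m H).
  have := mulVmx resolvent_unit => /(congr1 (mulmx x)).
  by rewrite mulmx1 mulmxA mulmxDr mulmx1 -scalemxAr.
exists (x *m L) => //; rewrite mulmxBr mulmx1 -scalemxAr.
rewrite [in X in _ - X]xE scaler_nat mulr2n opprD addrA addrK.
by [].
Qed.

(** In terms of [w] the value is [|w|^2 - gamma^2 |w H|^2], at least [(1 - gamma |H|) |w|^2]. *)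
Lemma reflection_pd x : x != 0 -> 0 < dot (x *m P) x.
Proof.
have [w xE xP] := resolvent_split x => x0.
have w0 : w != 0.
  by apply: contraNN x0 => /eqP w0; rewrite xE w0 mul0mx scaler0 addr0.
rewrite xP [X in dot _ X]xE.
have := hessian_cocoercive w; set h := w *m H => c1.
have c2 : dot h w <= opnorm H * dot w w.
  rewrite (le_trans (ler_norm _))// (le_trans (dot_le_enorm _ _))//.
  rewrite -sqr_enorm expr2 mulrA ler_wpM2r ?enorm_ge0//.
  by have := opnorm_le H w; rewrite Hsym.
clearbody h; rewrite !dot_lin (dotC w h).
have c3 : 0 < (1 - gamma * opnorm H) * dot w w.
  by rewrite mulr_gt0 ?subr_gt0// dot_gt0.
have := ler_wpM2l (ltW gamma0) c1; have := ler_wpM2l (ltW gamma0) c2; lra.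
Qed.

Lemma reflection_contractive x : dot (x *m P) (x *m P) <= dot (x *m P) x.
Proof.
have [w xE ->] := resolvent_split x.
rewrite [X in _ <= dot _ X]xE; have := hessian_cocoercive w.
set h := w *m H; clearbody h; move=> c1; rewrite !dot_lin (dotC w h).
have := ler_wpM2l (ltW gamma0) c1; lra.
Qed.

Lemma DR_mx_sym : (DR_mx *m P)^T = DR_mx *m P.
Proof.
have St : (2 *: N - 1%:M)^T = 2 *: N - 1%:M.
  by rewrite linearB/= linearZ/= Nsym trmx1.
rewrite DR_mxE -scalemxAl linearZ/= mulmxDl mul1mx; congr (_ *: _).
by rewrite linearD/= !trmx_mul St reflection_sym mulmxA.
Qed.

(** With [y = x P], twice the value is [<x P, x> + 2 <y N, y> - |y|^2]; the middle term is
    nonnegative and [|y|^2 <= <x P, x>]. *)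
Lemma DR_mx_psd : psd (DR_mx *m P).
Proof.
move=> x; rewrite DR_mxE -scalemxAl mulmxDl mul1mx -scalemxAr dotZl.
rewrite mulr_ge0// mulmxDr dotDl.
have -> : dot (x *m (P *m (2 *: N - 1%:M) *m P)) x =
    dot (x *m P *m (2 *: N - 1%:M)) (x *m P).
  by rewrite !mulmxA [LHS]dot_mulmxl reflection_sym.
have := reflection_contractive x; set y := x *m P.
rewrite mulmxBr mulmx1 -scalemxAr dotBl dotZl => h.
have := Nfirm y; have := dot_ge0 (y *m N); lra.
Qed.

End DouglasRachfordMatrix.

(** * From a dominant direction to vanishing angles *)

Section TypeI.
Context {K : realType} {n : nat}.

Lemma acos_le (eps c : K) : 0 <= eps <= pi -> -1 <= c -> c <= 1 ->
  cos eps <= c -> acos c <= eps.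
Proof.
move=> epi c1 c2 ec; have cB : -1 <= c <= 1 by rewrite c1.
rewrite leNgt; apply/negP => lt.
have : cos (acos c) < cos eps.
  by rewrite ltr_cos ?in_itv//= acos_ge0// acos_lepi.
by rewrite acosK ?in_itv//= ltNge ec.
Qed.

Lemma acos_near1 (eps : K) : 0 < eps -> exists2 d : K, 0 < d &
  forall c, 1 - d <= c -> c <= 1 -> `|acos c| <= eps.
Proof.
move=> e0; pose e := Num.min eps pi.
have e_gt0 : 0 < e by rewrite lt_min e0 pi_gt0.
have epi : 0 <= e <= pi by rewrite (ltW e_gt0) ge_min lexx orbT.
have ce : cos e < 1.
  by rewrite -(@cos0 K) ltr_cos// in_itv/= lexx pi_ge0.
exists (Num.min 1 (1 - cos e)) => [|c]; first by rewrite lt_min ltr01 subr_gt0.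
rewrite lerBlDr -lerBlDl => h c1.
have : 1 - c <= Num.min 1 (1 - cos e) by [].
rewrite le_min => /andP[h1 h2]; have cN1 : -1 <= c by lra.
rewrite ger0_norm ?acos_ge0 ?cN1//.
apply: (@le_trans _ _ e); last by rewrite ge_min lexx.
apply: acos_le => //; lra.
Qed.

(** If [w = lam v + r] with [|r| <= e |v|], the cosine of the angle between [w] and [v] is at least
    [(lam - e) / (lam + e)]. *)
Lemma type_I_of_dominant (z : nat -> 'rV[K]_n) (lam : K) : 0 < lam ->
  (\forall k \near \oo, z k - z k.-1 != 0) ->
  (forall eps : K, 0 < eps -> \forall k \near \oo,
    `|(z k.+1 - z k) - lam *: (z k - z k.-1)| <= eps * `|z k - z k.-1|) ->
  type_I z.
Proof.
move=> lam0 zn zl; rewrite /type_I -(cvg_shiftS (angle z)).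
apply/cvgrPdist_le => eps eps0.
have [d d0 Hd] := acos_near1 eps0.
(* [e <= lam / 2] keeps [<w, v>] positive, and [e <= lam (d / 4)] gives
   [(1 - d) (lam + e) <= lam - e]. *)
pose e := Num.min (lam / 2) (lam * (d / 4)).
have e0 : 0 < e by rewrite lt_min !divr_gt0//= mulr_gt0// divr_gt0.
have e1 : e <= lam / 2 by rewrite ge_min lexx.
have e2 : e <= lam * (d / 4) by rewrite ge_min lexx orbT.
clearbody e.
have n1 : 0 < e / (n%:R + 1) by rewrite divr_gt0// ltr_wpDl.
apply: filterS2 zn (zl _ n1) => k zk h; rewrite sub0r normrN /angle /increment
  /=.
set v := z k - z k.-1 in zk h *; set w := z k.+1 - z k in h *.
have hr : enorm (w - lam *: v) <= e * enorm v.
  rewrite (le_trans (enorm_le_norm _))//.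
  apply: le_trans (ler_wpM2l (ler0n _ n) h) _.
  have ne : n%:R * (e / (n%:R + 1)) <= e.
    by rewrite mulrCA ger_pMr// ler_pdivrMr ?ltr_wpDl// mul1r lerDl.
  have ne0 : 0 <= n%:R * (e / (n%:R + 1)) by rewrite mulr_ge0// ltW.
  by rewrite mulrA ler_pM// norm_le_enorm.
have v0 : 0 < enorm v by rewrite /enorm sqrtr_gt0 dot_gt0.
set r := w - lam *: v in hr; have wE : w = lam *: v + r by rewrite addrC subrK.
have w_le : enorm w <= (lam + e) * enorm v.
  rewrite wE (le_trans (enormD _ _))// enormZ gtr0_norm// mulrDl lerD2l//.
have dot_ge : (lam - e) * enorm v ^+ 2 <= dot w v.
  rewrite wE dotDl dotZl -sqr_enorm mulrBl lerD2l//.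
  rewrite lerNl.
  rewrite (le_trans (ler_norm _))// normrN (le_trans (dot_le_enorm _ _))//.
  by rewrite expr2 mulrA ler_wpM2r ?enorm_ge0.
clearbody r; have le_pos : 0 < (lam - e) * enorm v ^+ 2.
  by rewrite mulr_gt0 ?exprn_gt0//; lra.
have w0 : 0 < enorm w.
  rewrite lt_def enorm_ge0 andbT; apply/eqP => w00.
  have := le_trans (ler_norm _) (dot_le_enorm w v); rewrite w00 mul0r; lra.
have wv : 0 < enorm w * enorm v by rewrite mulr_gt0.
apply: Hd; last first.
  by rewrite ler_pdivrMr// mul1r (le_trans (ler_norm _))// dot_le_enorm.
rewrite ler_pdivlMr// (le_trans _ dot_ge)//.
have [d1|d1] := lerP 1 d.
  by apply: le_trans (ltW le_pos); rewrite mulr_le0_ge0 ?subr_le0// ltW.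
have := ler_wpM2r (ltW v0) w_le.
rewrite -mulrA -expr2 => h1.
have h2 : (1 - d) * (enorm w * enorm v) <= (1 - d) * ((lam + e) * enorm v ^+ 2).
  by rewrite ler_wpM2l// subr_ge0 ltW.
rewrite (le_trans h2)// mulrA ler_wpM2r ?sqr_ge0//.
have := ler_wpM2l (ltW d0) (ltW e0); nra.
Qed.

End TypeI.

Section DouglasRachfordTypeI.
Context {K : realType} {n : nat}.
Variables (gamma : K) (H N : 'M[K]_n).
Hypotheses (gamma0 : 0 < gamma) (Hsym : H^T = H) (Hpsd : psd H).
Hypotheses (Nsym : N^T = N) (Nfirm : forall x : 'rV[K]_n, dot (x *m N) (x *m N)
  <= dot (x *m N) x).
Hypothesis gammaH : gamma * opnorm H < 1.

Local Notation M := (DR_mx gamma H N).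
Local Notation P := (reflection_mx gamma H).

(* Row increments transform by M^T, whereas M is self-adjoint for the form P;
   the substitution [d = e P] conjugates M^T to M because [P M^T = M P]. *)
Lemma DR_type_I (z : nat -> 'rV[K]_n) (c rho : K) :
  (forall eps : K, 0 < eps -> \forall k \near \oo,
    `|z k.+1 - z k - (z k - z k.-1) *m M^T| <= eps * `|z k - z k.-1|) ->
  0 < c -> (\forall k \near \oo, c * rho ^+ k <= `|z k - z k.-1|) ->
  second_largest_eigenvalue M < rho ->
  type_I z.
Proof.
move=> zM c0 zc srho.
have Psym := reflection_sym gamma Hsym.
have Ppd := reflection_pd gamma0 Hsym Hpsd gammaH.
have MPsym := DR_mx_sym gamma Hsym Nsym.
have MPpsd := DR_mx_psd gamma0 Hsym Hpsd Nsym Nfirm gammaH.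
have rho0 := le_lt_trans (second_largest_eigenvalue_ge0 Ppd MPpsd) srho.
have Pu := pd_unitmx Ppd.
have [k1 k10 Hk1] := mulmx_bounded P.
have [k2 k20 Hk2] := mulmx_bounded (invmx P).
have PT : P *m M^T = M *m P by rewrite -[in LHS]Psym -trmx_mul.
have TQ : M^T *m invmx P = invmx P *m M.
  apply: (can_inj (mulKmx Pu)); rewrite mulmxA PT mulmxK//.
  by rewrite mulmxA mulmxV// mul1mx.
pose d k : 'rV[K]_n := z k - z k.-1; pose e k := d k *m invmx P.
have dE k : d k = e k *m P by rewrite /e mulmxKV.
have [||||lam lam0 Hlam] := @dominant_eigenvalue K n P M Psym Ppd MPsym MPpsd e
  (c / k1) rho.
- move=> eps eps0.
  have e1 : 0 < eps / (k1 * k2) by rewrite divr_gt0// mulr_gt0.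
  apply: filterS (zM _ e1) => k; rewrite -/(d k) => h.
  have -> : e k.+1 - e k *m M = (d k.+1 - d k *m M^T) *m invmx P.
    by rewrite mulmxBl -[d k *m M^T *m _]mulmxA TQ mulmxA.
  apply: le_trans (Hk2 _) (le_trans (ler_wpM2l (ltW k20) h) _).
  have := Hk1 (e k); rewrite -dE => h2.
  apply: le_trans (ler_wpM2l (ltW k20) (ler_wpM2l (ltW e1) h2)) _.
  rewrite le_eqVlt; apply/orP; left; apply/eqP; field.
  by rewrite !gt_eqF.
- by rewrite divr_gt0.
- apply: filterS zc => k; rewrite -/(d k) dE => h.
  by rewrite mulrAC ler_pdivrMr// (le_trans h)// mulrC Hk1.
- by [].
apply: (type_I_of_dominant lam0).
  apply: filterS zc => k h; rewrite -normr_gt0 (lt_le_trans _ h)//.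
  by rewrite mulr_gt0// exprn_gt0.
move=> eps eps0.
have e1 : 0 < eps / (k1 * k2) by rewrite divr_gt0// mulr_gt0.
apply: filterS (Hlam _ e1) => k h.
rewrite -/(d k) -[z k.+1 - z k]/(d k.+1).
have -> : d k.+1 - lam *: d k = (e k.+1 - lam *: e k) *m P.
  by rewrite mulmxBl -scalemxAl -!dE.
apply: le_trans (Hk1 _) (le_trans (ler_wpM2l (ltW k10) h) _).
apply: le_trans (ler_wpM2l (ltW k10) (ler_wpM2l (ltW e1) (Hk2 _))) _.
rewrite le_eqVlt; apply/orP; left; apply/eqP; field.
by rewrite !gt_eqF.
Qed.

End DouglasRachfordTypeI.

(** * Increments along sequences *)

Section LandauSequences.
Context {K : realType}.
Implicit Types (b : nat -> K).

Definition small_o (V : normedModType K) (a : nat -> V) b :=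
  forall e : K, 0 < e -> \forall k \near \oo, `|a k| <= e * b k.

Definition big_O (V : normedModType K) (a : nat -> V) b :=
  exists2 c : K, 0 < c & \forall k \near \oo, `|a k| <= c * b k.

Lemma cvg_distP (V : normedModType K) (s : nat -> V) x :
  s @ \oo --> x <->
  forall e : K, 0 < e -> \forall k \near \oo, `|s k - x| < e.
Proof.
split=> [/cvgrPdist_lt H e /H|H].
  by apply: filterS => k; rewrite distrC.
by apply/cvgrPdist_lt => e /H; apply: filterS => k; rewrite distrC.
Qed.

Lemma cvg_shift1 (V : normedModType K) (s : nat -> V) (x : V) :
  s @ \oo --> x -> s (k.+1) @[k --> \oo] --> x.
Proof. by move=> sx; rewrite (cvg_shiftS s). Qed.

Lemma near_shift1 (Q : nat -> Prop) :
  (\forall k \near \oo, Q k.+1) -> \forall k \near \oo, Q k.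
Proof.
by move=> [N _ HN]; exists N.+1 => // -[//|k] /= Nk; exact: HN.
Qed.

Lemma near_shift1r (Q : nat -> Prop) :
  (\forall k \near \oo, Q k) -> \forall k \near \oo, Q k.+1.
Proof. by move=> [N _ HN]; exists N => // k /= Nk; apply: HN; exact: leqW. Qed.

Section Vector.
Context {V : normedModType K} (b : nat -> K).
Implicit Types (a c : nat -> V).

Lemma small_o_eq a c : (\forall k \near \oo, a k = c k) ->
  small_o a b -> small_o c b.
Proof. by move=> ac H e /H; apply: filterS2 ac => k ->. Qed.

Lemma small_oD a c : small_o a b -> small_o c b ->
  small_o (fun k => a k + c k) b.
Proof.
move=> ha hc e e0; have e2 : 0 < e / 2 by rewrite divr_gt0.
apply: filterS2 (ha _ e2) (hc _ e2) => k h1 h2.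
by rewrite (le_trans (ler_normD _ _))//; lra.
Qed.

Lemma small_oN a : small_o a b -> small_o (fun k => - a k) b.
Proof. by move=> ha e /ha; apply: filterS => k; rewrite normrN. Qed.

Lemma small_oB a c : small_o a b -> small_o c b ->
  small_o (fun k => a k - c k) b.
Proof. by move=> ha hc; exact: small_oD ha (small_oN hc). Qed.

Lemma big_OD a c : big_O a b -> big_O c b ->
  big_O (fun k => a k + c k) b.
Proof.
move=> [x x0 hx] [y y0 hy]; exists (x + y); first exact: addr_gt0.
apply: filterS2 hx hy => k h1 h2.
by rewrite (le_trans (ler_normD _ _))// mulrDl lerD.
Qed.

Lemma big_ON a : big_O a b -> big_O (fun k => - a k) b.
Proof.
by move=> [x x0 h]; exists x => //; apply: filterS h => k; rewrite normrN.
Qed.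

End Vector.

Lemma small_o_mulmx m n (A : 'M[K]_(m, n)) (a : nat -> 'rV[K]_m) b :
  small_o a b -> small_o (fun k => a k *m A) b.
Proof.
have [c c0 hc] := mulmx_bounded A => ha e e0.
apply: filterS (ha _ (divr_gt0 e0 c0)) => k h.
rewrite (le_trans (hc _))// (le_trans (ler_wpM2l (ltW c0) h))//.
by rewrite mulrA mulrCA divff ?mulr1// gt_eqF.
Qed.

Lemma big_O_mulmx m n (A : 'M[K]_(m, n)) (a : nat -> 'rV[K]_m) b :
  big_O a b -> big_O (fun k => a k *m A) b.
Proof.
have [c c0 hc] := mulmx_bounded A => -[x x0 hx].
exists (c * x); first exact: mulr_gt0.
apply: filterS hx => k h.
by rewrite (le_trans (hc _))// -mulrA ler_wpM2l// ltW.
Qed.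

Lemma small_o_coord n (a : nat -> 'rV[K]_n) b :
  (\forall k \near \oo, 0 <= b k) ->
  (forall i, small_o (fun k => a k 0 i : K^o) b) -> small_o a b.
Proof.
move=> b0 H e e0.
have : \forall k \near \oo, forall i, `|a k 0 i| <= e * b k.
  by apply: filter_forall => i; exact: H.
apply: filterS2 b0 => k bk; apply: norm_le_coord.
by rewrite mulr_ge0// ltW.
Qed.

Lemma small_o_dot_l n (a w : nat -> 'rV[K]_n) b :
  (\forall k \near \oo, 0 <= b k) ->
  (a @ \oo --> (0 : 'rV[K]_n)) -> big_O w b ->
  small_o (fun k => dot (a k) (w k) : K^o) b.
Proof.
move=> b0 /cvg_distP a0 [c c0 hc] e e0.
have e1 : 0 < e / (n.+1%:R * c) by rewrite divr_gt0// mulr_gt0.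
apply: filterS3 b0 (a0 _ e1) hc => k bk; rewrite subr0 => /ltW h1 h2.
rewrite (le_trans (norm_dot_le _ _))//.
apply: le_trans (ler_wpM2l (ler0n _ n) (ler_pM _ _ h1 h2)) _ => //.
apply: (@le_trans _ _ (n.+1%:R * (e / (n.+1%:R * c) * (c * b k)))).
  rewrite ler_wpM2r ?ler_nat//.
  by apply: mulr_ge0 (ltW e1) (mulr_ge0 (ltW c0) bk).
rewrite le_eqVlt; apply/orP; left; apply/eqP; field.
by rewrite nat1r !gt_eqF.
Qed.

Lemma strict_increment m n (f : 'rV[K]_m -> 'rV[K]_n) A x
    (s : nat -> 'rV[K]_m) b :
  strictly_differentiable f A x -> s @ \oo --> x ->
  big_O (fun k => s k.+1 - s k) b ->
  small_o (fun k => f (s k.+1) - f (s k) - (s k.+1 - s k) *m A) b.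
Proof.
move=> sf sx [c c0 hc] e e0; have [d d0 H] := sf _ (divr_gt0 e0 c0).
have /cvg_distP/(_ _ d0) s1 := sx.
have /cvg_distP/(_ _ d0) s2 := cvg_shift1 sx.
apply: filterS3 s1 s2 hc => k h1 h2 h3.
rewrite (le_trans (H _ _ h2 h1))//.
apply: le_trans (ler_wpM2l _ h3) _; first by rewrite divr_ge0// ltW.
by rewrite mulrA divfK// gt_eqF.
Qed.

Lemma strict_increment_big_O m n (f : 'rV[K]_m -> 'rV[K]_n) A x
    (s : nat -> 'rV[K]_m) b :
  strictly_differentiable f A x -> s @ \oo --> x ->
  big_O (fun k => s k.+1 - s k) b ->
  big_O (fun k => f (s k.+1) - f (s k)) b.
Proof.
move=> sf sx sb; have [c c0 hc] := big_O_mulmx A sb.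
exists (1 + c); first exact: addr_gt0.
apply: filterS2 hc (strict_increment sf sx sb ltr01) => k h1 h2.
rewrite -[f _ - f _](subrK ((s k.+1 - s k) *m A)) (le_trans (ler_normD _ _))//.
by rewrite mulrDl lerD.
Qed.

Lemma strict_cvg m n (f : 'rV[K]_m -> 'rV[K]_n) A x (s : nat -> 'rV[K]_m) :
  strictly_differentiable f A x -> s @ \oo --> x ->
  f (s k) @[k --> \oo] --> f x.
Proof.
move=> /strict_continuous/continuous_distP fx /cvg_distP sx.
apply/cvg_distP => e e0; have e2 : 0 < e / 2 by rewrite divr_gt0.
have [d d0 Hd] := fx _ e2; apply: filterS (sx _ d0) => k /Hd; lra.
Qed.

(** Tested on [x + t e_i] and [x]. It identifies the products of the Jacobians of [phi] and [psi]
    with the identity. *)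
Lemma strict_unique m n (f : 'rV[K]_m -> 'rV[K]_n) A B x :
  strictly_differentiable f A x -> strictly_differentiable f B x -> A = B.
Proof.
move=> sA sB; apply/row_matrixP => i; rewrite !rowE.
set v := delta_mx 0 i; apply/eqP; rewrite -subr_eq0 -normr_le0.
apply/ler_addgt0Pr => e e0; rewrite add0r.
pose c := 2 * (1 + `|v|); have c0 : 0 < c by rewrite mulr_gt0// ltr_pwDl.
have [d1 d10 H1] := sA _ (divr_gt0 e0 c0).
have [d2 d20 H2] := sB _ (divr_gt0 e0 c0).
have d0 : 0 < Num.min d1 d2 by rewrite lt_min d10.
have [r r0 Hr] := dist_segment x v d0.
have [t t0 tr] : exists2 t, 0 < t & t < r by exists (r / 2); lra.
have := Hr t; rewrite gtr0_norm// lt_min => /(_ tr)/andP[h1 h2].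
have x1 : `|x - x| < d1 by rewrite subrr normr0.
have x2 : `|x - x| < d2 by rewrite subrr normr0.
have := H1 _ _ h1 x1; have := H2 _ _ h2 x2.
rewrite [x + _ - x]addrAC subrr add0r -!scalemxAl normrZ (gtr0_norm t0).
set y := f _ - f _ => i2 i1.
rewrite -(ler_pM2l t0) -[t in leLHS]gtr0_norm// -normrZ scalerBr.
have -> : t *: (v *m A) - t *: (v *m B) =
  (y - t *: (v *m B)) - (y - t *: (v *m A)).
  by rewrite opprB [RHS]addrC subrKA.
rewrite (le_trans (ler_normB _ _))// (le_trans (lerD i2 i1))//.
have -> : e / c * (t * `|v|) + e / c * (t * `|v|) = t * (e * (2 * `|v| / c)).
  by rewrite /c; field; rewrite gt_eqF// ltr_pwDl.
rewrite ler_wpM2l ?(ltW t0)// ger_pMr// ler_pdivrMr// mul1r /c.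
by rewrite ler_wpM2l// lerDr.
Qed.

End LandauSequences.

(** * Slice charts *)

Section DirectionalDerivatives.
Context {K : realType}.

Lemma derive_comp (U V W : normedModType K) (f : U -> V) (g : V -> W) x v :
  differentiable f x -> differentiable g (f x) ->
  'D_v (g \o f) x = 'D_('D_v f x) g (f x).
Proof.
move=> df dg; have dgf := differentiable_comp df dg.
by rewrite (deriveE _ dgf) (diff_comp df dg) /= (deriveE _ dg) (deriveE _ df).
Qed.

Lemma linear_bounded_derive (V W : normedModType K) (f : V -> W) (c : K) x v :
  linear f -> (forall y, `|f y| <= c * `|y|) ->
  differentiable f x /\ 'D_v f x = f v.
Proof.
move=> lf fc; pose fM := GRing.isLinear.Build _ _ _ _ _ lf.
pose fL : {linear V -> W} := HB.pack f fM.
have cf : continuous fL.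
  move=> y; apply/continuous_distP => e e0.
  have c0 : 0 < 1 + `|c| by rewrite ltr_pwDl.
  exists (e / (1 + `|c|)) => [|y']; first by rewrite divr_gt0.
  rewrite ltr_pdivlMr// => /ltW h; rewrite -[fL y' - fL y]linearB/=.
  rewrite (le_trans (fc _))// (le_trans _ h)// mulrC ler_wpM2l//.
  by rewrite (le_trans (ler_norm _))// lerDr.
have df : differentiable f x := linear_differentiable x cf.
by split => //; rewrite (deriveE _ df) -[f]/(fL : V -> W) (diff_lin _ cf).
Qed.

Lemma derive_mulmx m n (A : 'M[K]_(m, n)) (x v : 'rV[K]_m) :
  differentiable (fun y : 'rV[K]_m => y *m A) x /\
  'D_v (fun y : 'rV[K]_m => y *m A) x = v *m A.
Proof.
have [c _ Hc] := mulmx_bounded A; apply: (linear_bounded_derive _ _ _ Hc).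
by move=> a y z; rewrite mulmxDl scalemxAl.
Qed.

Lemma derive_dot n (c x v : 'rV[K]_n) :
  differentiable (fun y => dot c y : K^o) x /\
  'D_v (fun y => dot c y : K^o) x = dot c v.
Proof.
apply: (@linear_bounded_derive _ K^o _ (n%:R * `|c|)).
  by move=> a y z; rewrite dotDr dotZr.
by move=> y; rewrite -mulrA; exact: norm_dot_le.
Qed.

Lemma Ck2_Ck1 (V W : normedModType K) (U : set V) (f : V -> W) :
  Ck 2 U f -> Ck 1 U f.
Proof.
move=> [df C1]; split=> // v x Ux.
exact: (differentiable_continuous ((C1 v).1 x Ux)).
Qed.

Lemma mul_pid_mx_coord n d (v : 'rV[K]_n) i :
  (v *m (pid_mx d : 'M[K]_n)) 0 i = if (i < d)%N then v 0 i else 0.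
Proof.
rewrite mxE (bigD1 i)//= big1 => [|j ji].
  by rewrite !mxE eqxx addr0/=; case: ifP; rewrite ?mulr1 ?mulr0.
by rewrite !mxE (val_eqE j i) (negbTE ji) mulr0.
Qed.

Lemma dot_sumr n (I : finType) (a : 'rV[K]_n) (F : I -> 'rV[K]_n) :
  dot a (\sum_i F i) = \sum_i dot a (F i).
Proof.
apply: (big_morph (dot a)) => [y z|]; [exact: dotDr|exact: dot0r].
Qed.

End DirectionalDerivatives.

Section Chart.
Context {K : realType} {n : nat}.
Variables (M U V : set 'rV[K]_n) (d : nat) (phi psi : 'rV[K]_n -> 'rV[K]_n).
Variable xs : 'rV[K]_n.

Definition slice_chart :=
  [/\ (d <= n)%N, open U /\ U xs, open V,
      [/\ Ck 2 U phi, Ck 2 V psi,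
          forall y, U y -> V (phi y) /\ psi (phi y) = y &
          forall y, V y -> U (psi y) /\ phi (psi y) = y] &
      forall y, U y -> (M y <-> forall i : 'I_n, (d <= i)%N -> phi y 0 i = 0)].

Hypotheses (chart : slice_chart) (Mxs : M xs).

Lemma chart_dim : (d <= n)%N. Proof. by case: chart. Qed.
Lemma chart_openU : open U. Proof. by case: chart => _ []. Qed.
Lemma chart_Uxs : U xs. Proof. by case: chart => _ []. Qed.
Lemma chart_openV : open V. Proof. by case: chart. Qed.
Lemma chart_C2phi : Ck 2 U phi. Proof. by case: chart => _ _ _ []. Qed.
Lemma chart_C2psi : Ck 2 V psi. Proof. by case: chart => _ _ _ []. Qed.

Lemma chart_phiK y : U y -> V (phi y) /\ psi (phi y) = y.
Proof. by case: chart => _ _ _ [_ _ + _] _; apply. Qed.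

Lemma chart_psiK y : V y -> U (psi y) /\ phi (psi y) = y.
Proof. by case: chart => _ _ _ [_ _ _ +] _; apply. Qed.

Lemma chart_slice y : U y ->
  M y <-> forall i : 'I_n, (d <= i)%N -> phi y 0 i = 0.
Proof. by case: chart => _ _ _ _; apply. Qed.

Local Notation proj := (pid_mx d : 'M[K]_n).
Local Notation xi := (phi xs).
Local Notation Jphi := (jacobian phi xs).
Local Notation Jpsi := (jacobian psi xi).

Lemma chart_Vxi : V xi. Proof. exact: (chart_phiK chart_Uxs).1. Qed.

Lemma chart_sliceP y : U y -> M y <-> phi y *m proj = phi y.
Proof.
move=> Uy; rewrite (chart_slice Uy); split=> [H|<- i di].
  apply/rowP => i; rewrite mul_pid_mx_coord; case: ltnP => // /H ->.
  by [].
by rewrite mul_pid_mx_coord ltnNge di.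
Qed.

Lemma chart_xi_proj : xi *m proj = xi.
Proof. exact/(chart_sliceP chart_Uxs). Qed.

Lemma chart_strict_phi : strictly_differentiable phi Jphi xs.
Proof. exact: (strict_C1 chart_openU chart_Uxs (Ck2_Ck1 chart_C2phi)). Qed.

Lemma chart_strict_psi : strictly_differentiable psi Jpsi xi.
Proof. exact: (strict_C1 chart_openV chart_Vxi (Ck2_Ck1 chart_C2psi)). Qed.

Lemma strict_id_matrix (f : 'rV[K]_n -> 'rV[K]_n) A x :
  (\forall y \near x, f y = y) -> strictly_differentiable f A x -> A = 1%:M.
Proof.
move=> fid sf; apply: (strict_unique sf).
apply: strict_near (strict_mulmx 1%:M x).
by apply: filterS fid => y ->; rewrite mulmx1.
Qed.

Lemma chart_JphiK : Jphi *m Jpsi = 1%:M.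
Proof.
apply: strict_id_matrix (strict_comp chart_strict_phi chart_strict_psi).
by apply: filterS (open_nbhs_nbhs (conj chart_openU chart_Uxs)) => y
  /chart_phiK[].
Qed.

Lemma chart_JpsiK : Jpsi *m Jphi = 1%:M.
Proof.
have sphi : strictly_differentiable phi Jphi (psi xi).
  by rewrite (chart_phiK chart_Uxs).2; exact: chart_strict_phi.
apply: strict_id_matrix (strict_comp chart_strict_psi sphi).
by apply: filterS (open_nbhs_nbhs (conj chart_openV chart_Vxi)) => y
  /chart_psiK[].
Qed.

Local Notation Psi := (fun eta : 'rV[K]_n => psi (eta *m proj)).
Local Notation B := (proj *m Jpsi).

(** [Psi] parametrizes [M] from an open part of the whole of R^n: [proj] discards the last [n - d]
    coordinates, so every matrix stays square. *)
Lemma chart_strict_Psi : strictly_differentiable Psi B xi.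
Proof.
apply: (strict_comp (strict_mulmx proj xi)).
by rewrite chart_xi_proj; exact: chart_strict_psi.
Qed.

Lemma chart_Psi_xi : psi (xi *m proj) = xs.
Proof. by rewrite chart_xi_proj (chart_phiK chart_Uxs).2. Qed.

Lemma chart_neighbourhood (O : set 'rV[K]_n) : open O -> O xs ->
  exists2 r : K, 0 < r & forall eta, `|eta - xi| < r ->
    [/\ V (eta *m proj), O (Psi eta), U (Psi eta) & M (Psi eta)].
Proof.
move=> oO Oxs.
have [r1 r10 H1] : exists2 r : K, 0 < r & forall y, `|y - xi| < r -> V y.
  by apply/near_distP; exact: (open_nbhs_nbhs (conj chart_openV chart_Vxi)).
have [r2 r20 H2] : exists2 r : K, 0 < r & forall y, `|y - xs| < r -> O y.
  by apply/near_distP; exact: (open_nbhs_nbhs (conj oO Oxs)).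
have r1' : 0 < r1 / 2 by rewrite divr_gt0.
have r2' : 0 < r2 / 2 by rewrite divr_gt0.
have [r3 r30 H3] := (continuous_distP _ _).1
  (strict_continuous (strict_mulmx proj xi)) _ r1'.
have [r4 r40 H4] := (continuous_distP _ _).1
  (strict_continuous chart_strict_Psi) _ r2'.
exists (Num.min r3 r4) => [|eta]; first by rewrite lt_min r30.
rewrite lt_min => /andP[/H3 h3 /H4 h4].
have Veta : V (eta *m proj).
  by apply: H1; rewrite -[X in _ - X]chart_xi_proj; lra.
have Ueta := (chart_psiK Veta).1.
split=> //; first by apply: H2; rewrite -chart_Psi_xi; lra.
by apply/(chart_sliceP Ueta); rewrite (chart_psiK Veta).2 -mulmxA pid_mx_id//
  chart_dim.
Qed.

End Chart.

(** * Linearization of the proximal map of [J] along the manifold *)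

Section ManifoldIncrements.
Context {K : realType} {n : nat}.
Variables (M U V : set 'rV[K]_n) (d : nat) (phi psi : 'rV[K]_n -> 'rV[K]_n).
Variables (xs zs : 'rV[K]_n) (gamma : K).
Variables (J : 'rV[K]_n -> \bar K) (Ug : set 'rV[K]_n) (g : 'rV[K]_n -> K^o).
Hypotheses (chart : slice_chart M U V d phi psi xs) (Mxs : M xs).
Hypotheses (gamma0 : 0 < gamma).
Hypotheses (oUg : open Ug) (Ugxs : Ug xs) (C2g : Ck 2 Ug g).
Hypothesis Jg : forall y, M y -> Ug y -> J y = (g y)%:E.
Hypothesis sub_xs : subdifferential J xs (gamma^-1 *: (zs - xs)).

Local Notation proj := (pid_mx d : 'M[K]_n).
Local Notation xi := (phi xs).
Local Notation Jpsi := (jacobian psi xi).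
Local Notation Psi := (fun eta : 'rV[K]_n => psi (eta *m proj)).
Local Notation B := (proj *m Jpsi).

(** A point [x] of [M] with [x = prox (z)] is critical along [M] for [gamma J - <z - x, .>]; this
    function is read here in the chart, with [g] for [J] and [c] for [z - x]. *)
Definition tilted (c eta : 'rV[K]_n) : K^o :=
  gamma * g (psi (eta *m proj)) - dot c (psi (eta *m proj)).

Lemma derive_tilted c eta v : V (eta *m proj) -> Ug (Psi eta) ->
  differentiable (tilted c) eta /\
  'D_v (tilted c) eta =
    dot (gamma *: gradient g (Psi eta) - c) ('D_(v *m proj) psi (eta *m proj)).
Proof.
move=> Veta Ugeta.
have [dm Dm] := derive_mulmx proj eta v.
have dpsi : differentiable psi (eta *m proj) := (chart_C2psi chart).1 _ Veta.
have dPsi : differentiable Psi eta := differentiable_comp dm dpsi.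
have DPsi : 'D_v Psi eta = 'D_(v *m proj) psi (eta *m proj).
  by rewrite -Dm; exact: derive_comp.
pose q y : K^o := gamma * g y - dot c y.
have dg := C2g.1 _ Ugeta.
have [dc _] := derive_dot c (Psi eta) 0.
have dgg : differentiable (gamma *: g) (Psi eta) by exact: differentiableZ.
have dq : differentiable q (Psi eta).
  exact: (differentiableB dgg dc).
have Dq w : 'D_w q (Psi eta) = dot (gamma *: gradient g (Psi eta) - c) w.
  rewrite (@deriveB _ _ _ (gamma *: g) (fun y => dot c y : K^o)).
  - rewrite deriveZ ?(derive_dot c (Psi eta) w).2 ?derive_gradient//.
      by rewrite dotBl dotZl.
    exact: diff_derivable.
  - exact: diff_derivable.
  - exact: diff_derivable.
split; first exact: (differentiable_comp dPsi dq).
by rewrite -DPsi -Dq; exact: derive_comp.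
Qed.

(** The gradient of [tilted] for the limiting residual [zs - xs], as a formula in the first
    derivatives of [g] and [psi]; these are C^1, which makes it strictly differentiable. *)
Definition chart_gradient (eta : 'rV[K]_n) : 'rV[K]_n :=
  \row_j dot (gamma *: gradient g (Psi eta) - (zs - xs))
             ('D_(delta_mx 0 j *m proj) psi (eta *m proj)).

Lemma derive_psi_sum eta v : V (eta *m proj) ->
  'D_(v *m proj) psi (eta *m proj) =
  \sum_j v 0 j *: 'D_(delta_mx 0 j *m proj) psi (eta *m proj).
Proof.
move=> Veta; have dpsi := (chart_C2psi chart).1 _ Veta.
rewrite [in LHS](row_sum_delta v) mulmx_suml deriveE// linear_sum.
by apply: eq_bigr => j _; rewrite -scalemxAl linearZ deriveE.
Qed.

Lemma chart_gradientP : has_gradient_near (tilted (zs - xs)) chart_gradient xi.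
Proof.
have [r r0 H] := chart_neighbourhood chart Mxs oUg Ugxs.
apply/near_distP; exists r => // eta /H[Veta Ugeta _ _]; split=> [|v].
  exact: (derive_tilted (zs - xs) 0 Veta Ugeta).1.
rewrite (derive_tilted (zs - xs) v Veta Ugeta).2 derive_psi_sum// dot_sumr dotE.
by apply: eq_bigr => j _; rewrite mxE dotZr mulrC.
Qed.

Lemma strict_chart_gradient :
  exists S, strictly_differentiable chart_gradient S xi.
Proof.
have sPsi := chart_strict_Psi chart Mxs.
have sg : strictly_differentiable (gradient g) (hessian g xs) (psi (xi *m
  proj)).
  by rewrite (chart_Psi_xi chart Mxs); exact: (strict_gradient oUg Ugxs C2g).
have sa := strict_affine gamma (- (zs - xs)) (strict_comp sPsi sg).
pose b (j : 'I_n) eta := 'D_(delta_mx 0 j *m proj) psi (eta *m proj).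
suff sb j : exists B', strictly_differentiable (b j) B' xi.
  by have [S HS] := strict_row_dot sa sb; exists S.
pose w eta := 'D_(delta_mx 0 j *m proj) psi eta.
have sw : strictly_differentiable w (jacobian w xi) (xi *m proj).
  rewrite (chart_xi_proj chart Mxs).
  apply: (strict_C1 (chart_openV chart) (chart_Vxi chart)).
  exact: ((chart_C2psi chart).2 _).
by exists (proj *m jacobian w xi); exact: (strict_comp (strict_mulmx proj xi)
  sw).
Qed.

(* Fermat's rule along the chart: a subgradient of J at a point of M agrees
   with the gradient of the extension g in the directions tangent to M. *)
Lemma chart_gradient_subgradient : exists2 r : K, 0 < r &
  forall eta c, `|eta - xi| < r -> eta *m proj = eta ->
    subdifferential J (psi eta) (gamma^-1 *: c) ->
    chart_gradient eta =
    \row_j dot (c - (zs - xs)) ('D_(delta_mx 0 j *m proj) psi eta).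
Proof.
have [r r0 H] := chart_neighbourhood chart Mxs oUg Ugxs.
exists r => // eta c eta_r eta_p gc; have [Veta Ugeta Ueta Meta] := H _ eta_r.
have r1 : 0 < r - `|eta - xi| by rewrite subr_gt0.
have near_r y : `|y - eta| < r - `|eta - xi| -> `|y - xi| < r.
  rewrite ltrBrDr => /(le_lt_trans _); apply.
  by rewrite -[y - xi](subrKA eta) ler_normD.
have crit v : 'D_v (tilted c) eta = dot 0 v.
  apply: Fermat_subgradient; apply/near_distP; exists (r - `|eta - xi|) => //.
    by move=> y /near_r /H[Vy Ugy _ _]; exact: (derive_tilted c 0 Vy Ugy).1.
  move=> y /near_r /H[Vy Ugy _ My]; rewrite dot0l addr0.
  rewrite eta_p in Ugeta Meta.
  have Jeta := Jg Meta Ugeta; have Jy := Jg My Ugy.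
  have := subgradient_fine (y := Psi y) _ _ gc.
  rewrite Jeta Jy /= => /(_ isT isT).
  rewrite -(ler_pM2l gamma0) dotZl mulrDr mulVKf ?gt_eqF// dotBr.
  by rewrite /tilted eta_p; lra.
apply/rowP => j; rewrite !mxE.
have := crit (delta_mx 0 j); rewrite (derive_tilted c _ Veta Ugeta).2 eta_p.
rewrite !dot_lin dot0l; lra.
Qed.

(** With [dxi] the increment in the chart, up to o(|dz|): [dxi S = (dz - dx) B^T], [dx = dxi B] and
    [dxi E = 0]. Together they give [dxi Q = dz B^T], whence [N = B^T Q^-1 B]. *)
Lemma manifold_increment (x z : nat -> 'rV[K]_n) :
  x @ \oo --> xs -> z @ \oo --> zs ->
  (\forall k \near \oo, M (x k)) ->
  (forall k, subdifferential J (x k) (gamma^-1 *: (z k - x k))) ->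
  big_O (fun k => x k.+1 - x k) (fun k => `|z k.+1 - z k|) ->
  exists N : 'M[K]_n,
    [/\ N^T = N,
        forall v : 'rV[K]_n, dot (v *m N) (v *m N) <= dot (v *m N) v &
        small_o (fun k => x k.+1 - x k - (z k.+1 - z k) *m N)
                   (fun k => `|z k.+1 - z k|)].
Proof.
move=> xxs zzs Mx gx dx.
have [r r0 Hr] := chart_gradient_subgradient.
have [S sS] := strict_chart_gradient.
have xi_p := chart_xi_proj chart Mxs.
have grad_xi : chart_gradient xi = 0.
  have := Hr xi (zs - xs); rewrite subrr normr0 (chart_phiK chart (chart_Uxs
    chart)).2.
  move=> /(_ r0 xi_p sub_xs) ->.
  by apply/rowP => j; rewrite !mxE subrr dot0l.
have Ssym : S^T = S := strict_hessian_sym chart_gradientP sS.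
have Spsd : psd S.
  apply: (strict_hessian_psd chart_gradientP sS).
  have [r1 r10 H1] := chart_neighbourhood chart Mxs oUg Ugxs.
  apply/near_distP; exists r1 => // y /H1[_ Ugy _ My].
  rewrite grad_xi dot0l addr0 /tilted xi_p.
  rewrite (chart_phiK chart (chart_Uxs chart)).2.
  have Jxs := Jg Mxs Ugxs; have Jy := Jg My Ugy.
  have := subgradient_fine (y := Psi y) _ _ sub_xs.
  rewrite Jxs Jy /= => /(_ isT isT).
  by rewrite -(ler_pM2l gamma0) dotZl mulrDr mulVKf ?gt_eqF// dotBr; lra.
pose E : 'M[K]_n := 1%:M - proj.
have proj_sym : proj^T = proj by rewrite tr_pid_mx.
have proj_id : proj *m proj = proj by rewrite pid_mx_id// (chart_dim chart).
have Esym : E^T = E by rewrite linearB/= trmx1 proj_sym.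
have Eid : E *m E = E.
  by rewrite /E mulmxBr mulmx1 mulmxBl mul1mx proj_id subrr subr0.
have vE (v : 'rV[K]_n) : v *m E = v - v *m proj by rewrite mulmxBr mulmx1.
(* [S] and [B B^T] ignore the last [n - d] coordinates; [E], the projector on them, makes [Q]
   definite without affecting chart increments, where these coordinates vanish. *)
clearbody E; pose Q : 'M[K]_n := S + B *m B^T + E.
have QE (v w : 'rV[K]_n) : dot (v *m Q) w =
    dot (v *m S) w + dot (v *m B) (w *m B) + dot (v *m E) (w *m E).
  have EE : dot (v *m E) w = dot (v *m E) (w *m E).
    by rewrite -{1}Eid mulmxA dot_mulmxl Esym.
  have BB : dot (v *m (B *m B^T)) w = dot (v *m B) (w *m B).
    by rewrite mulmxA [LHS]dot_mulmxl trmxK.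
  by rewrite /Q !mulmxDr !dotDl BB EE.
have Qge (v : 'rV[K]_n) : dot (v *m B) (v *m B) <= dot (v *m Q) v.
  rewrite QE; have := Spsd v; have := dot_ge0 (v *m E); lra.
(* If the value is 0, then [v E = 0] puts [v] in the slice, and [v B = 0] says that the invertible
   Jacobian of [psi] annihilates it. *)
have Qpd (v : 'rV[K]_n) : v != 0 -> 0 < dot (v *m Q) v.
  move=> v0; rewrite lt_def (le_trans (dot_ge0 _) (Qge v)) andbT.
  apply: contraNN v0 => /eqP Q0; have := QE v v; rewrite Q0.
  have := Spsd v; have := dot_ge0 (v *m E); have := dot_ge0 (v *m B).
  move=> h1 h2 h3 h4.
  have /eqP : dot (v *m B) (v *m B) = 0 by lra.
  have /eqP : dot (v *m E) (v *m E) = 0 by lra.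
  rewrite !dot_eq0 vE subr_eq0 mulmxA => /eqP <- /eqP vJ.
  by rewrite -[v]mulmx1 -(chart_JpsiK chart) mulmxA vJ mul0mx.
have Qsym : Q^T = Q.
  by rewrite /Q !linearD/= Ssym Esym trmx_mul trmxK.
have Qu := pd_unitmx Qpd.
exists (B^T *m invmx Q *m B); split.
- rewrite [LHS]trmx_mul [X in _ *m X = _]trmx_mul trmxK trmx_inv Qsym.
  by rewrite [LHS]mulmxA.
(* [|y B|^2 <= <y Q, y>] because [S] and [E] are nonnegative, and the right-hand side is
   [<v N, v>]. *)
- move=> v; pose y := v *m B^T *m invmx Q.
  have -> : v *m (B^T *m invmx Q *m B) = y *m B by rewrite mulmxA [v *m
    _]mulmxA.
  apply: le_trans (Qge y) _; rewrite dot_mulmxl Qsym.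
  have -> : y *m Q = v *m B^T by rewrite /y mulmxKV.
  by rewrite [leRHS]dot_mulmxl.
pose b k := `|z k.+1 - z k|.
pose xik k := phi (x k).
have b0 : \forall k \near \oo, 0 <= b k.
  by apply: nearW => k; exact: normr_ge0.
have sphi := chart_strict_phi chart.
have dxi : big_O (fun k => xik k.+1 - xik k) b.
  exact: (strict_increment_big_O sphi xxs dx).
have xik_cvg : xik @ \oo --> xi := strict_cvg sphi xxs.
have near_U : \forall k \near \oo, U (x k).
  have [e e0 He] : exists2 e : K, 0 < e & forall y, `|y - xs| < e -> U y.
    by apply/near_distP; exact: (open_nbhs_nbhs (conj (chart_openU chart)
      (chart_Uxs chart))).
  by have /cvg_distP/(_ _ e0) := xxs; apply: filterS => k; exact: He.
have good : \forall k \near \oo, [/\ psi (xik k) = x k, xik k *m proj = xik k &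
    chart_gradient (xik k) = \row_j dot (z k - x k - (zs - xs))
      ('D_(delta_mx 0 j *m proj) psi (xik k))].
  have /cvg_distP/(_ _ r0) near_r := xik_cvg.
  apply: filterS3 near_U Mx near_r => k Uk Mk rk.
  have psik : psi (xik k) = x k := (chart_phiK chart Uk).2.
  have projk : xik k *m proj = xik k by exact/(chart_sliceP chart Uk).
  by split=> //; apply: Hr => //; rewrite psik.
have good' := near_shift1r good.
have n1 := strict_increment sS xik_cvg dxi.
have n2 : small_o (fun k => x k.+1 - x k - (xik k.+1 - xik k) *m B) b.
  apply: small_o_eq (strict_increment (chart_strict_psi chart) xik_cvg dxi).
  apply: filterS2 good good' => k [p1 p2 _] [p3 p4 _].
  have pD : (xik k.+1 - xik k) *m proj = xik k.+1 - xik k by rewrite mulmxBl p2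
    p4.
  by rewrite p1 p3 [in RHS]mulmxA pD.
have db : big_O (fun k => z k.+1 - z k) b.
  by exists 1 => //; apply: nearW => k; rewrite mul1r.
have dc : big_O (fun k => (z k.+1 - z k) - (x k.+1 - x k)) b.
  exact: big_OD db (big_ON dx).
have c_cvg : (fun k => z k - x k - (zs - xs)) @ \oo --> (0 : 'rV[K]_n).
  rewrite -[0](subrr (zs - xs)); apply: cvgB; last exact: cvg_cst.
  exact: cvgB.
(* The chart equation has on its right a product of the residual offset, which tends to 0, and a
   derivative of [psi]: only the increment of the first factor contributes to first order. *)
have n3 : small_o (fun k => chart_gradient (xik k.+1) - chart_gradient (xik k)
    - ((z k.+1 - z k) - (x k.+1 - x k)) *m B^T) b.
  apply: (small_o_coord b0) => j.
  pose w eta := 'D_(delta_mx 0 j *m proj) psi eta.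
  have sw : strictly_differentiable w (jacobian w xi) xi.
    apply: (strict_C1 (chart_openV chart) (chart_Vxi chart)).
    exact: ((chart_C2psi chart).2 _).
  have w_cvg : (fun k => w (xik k.+1) - w xi) @ \oo --> (0 : 'rV[K]_n).
    rewrite -[0](subrr (w xi)); apply: cvgB; last exact: cvg_cst.
    exact: (cvg_shift1 (strict_cvg sw xik_cvg)).
  have dw := strict_increment_big_O sw xik_cvg dxi.
  have m1 := small_o_dot_l b0 w_cvg dc.
  have m2 := small_o_dot_l b0 c_cvg dw.
  apply: small_o_eq (small_oD m1 m2).
  apply: filterS2 good good' => k [_ _ p1] [_ _ p2].
  rewrite p1 p2 !mxE -/(w _) -/(w _).
  have -> : \sum_j0 (z k.+1 - z k - (x k.+1 - x k)) 0 j0 * B^T j0 j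
     = dot (w xi) (z k.+1 - z k - (x k.+1 - x k)).
    rewrite /w deriveEjacobian; last exact: ((chart_C2psi chart).1 _ (chart_Vxi
      chart)).
    by rewrite dotC dotE; apply: eq_bigr => i _; rewrite -mulmxA -rowE !mxE.
  move: (w (xik k.+1)) (w (xik k)) (w xi) => a1 a2 a3.
  rewrite !dot_lin !(dotC a1) !(dotC a3); ring.
have n4 : small_o (fun k => (xik k.+1 - xik k) *m Q - (z k.+1 - z k) *m B^T) b.
  apply: small_o_eq (small_oB (small_oB n3 n1) (small_o_mulmx B^T n2)).
  apply: filterS2 good good' => k [_ p1 _] [_ p2 _].
  set dG := chart_gradient _ - chart_gradient _.
  have e1 : (xik k.+1 - xik k) *m E = 0.
    by rewrite vE mulmxBl p1 p2 subrr.
  rewrite /Q !mulmxDr e1 addr0.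
  set D := xik k.+1 - xik k; set Dz := z k.+1 - z k; set Dx := x k.+1 - x k.
  rewrite [D *m (B *m B^T)]mulmxA !mulmxBl.
  move: (D *m S) (D *m B *m B^T) (Dz *m B^T) (Dx *m B^T) dG => a1 a2 a3 a4 a5.
  by apply/rowP => i; rewrite !mxE; ring.
have n5 := small_o_mulmx (invmx Q *m B) n4.
apply: small_o_eq (small_oD n2 n5); apply: nearW => k.
set D := xik k.+1 - xik k; set Dz := z k.+1 - z k.
have -> : (D *m Q - Dz *m B^T) *m (invmx Q *m B) =
    D *m B - Dz *m (B^T *m invmx Q *m B).
  rewrite mulmxBl [D *m Q *m _]mulmxA mulmxK//; congr (_ - _).
  by rewrite -!mulmxA.
by rewrite addrA subrK.
Qed.

End ManifoldIncrements.

(** * Identification of the active manifold *)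

Section AffineHull.
Context {K : realType} {n : nat}.
Implicit Types (C : set 'rV[K]_n).

(** Concatenates the combinations, with weights [1], [t l1] and [- t l2] of total 1. *)
Lemma affine_hull_shift C p a b t : C p -> affine_hull C a ->
  affine_hull C b -> affine_hull C (p + t *: (a - b)).
Proof.
move=> Cp [m1 [l1 [p1 [C1 s1 ->]]]] [m2 [l2 [p2 [C2 s2 ->]]]].
exists (1 + (m1 + m2))%N.
exists (fun i => match fintype.split i with inl _ => 1 | inr j =>
  match fintype.split j with inl k => t * l1 k | inr k => - (t * l2 k) end end).
exists (fun i => match fintype.split i with inl _ => p | inr j =>
  match fintype.split j with inl k => p1 k | inr k => p2 k end end).
split.
- by move=> i; case: (fintype.split i) => // j; case: (fintype.split j).
- rewrite big_split_ord big_ord1 /= (unsplitK (inl _)) big_split_ord /=.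
  under eq_bigr do rewrite (unsplitK (inr _)) (unsplitK (inl _)).
  under [X in 1 + (_ + X)]eq_bigr do
    rewrite (unsplitK (inr _)) (unsplitK (inr _)).
  by rewrite -mulr_sumr sumrN -mulr_sumr s1 s2 subrr addr0.
- rewrite big_split_ord big_ord1 /= (unsplitK (inl _)) scale1r big_split_ord /=.
  under [X in _ + (X + _)]eq_bigr do
    rewrite (unsplitK (inr _)) (unsplitK (inl _)) -scalerA.
  under [X in _ + (_ + X)]eq_bigr do
    rewrite (unsplitK (inr _)) (unsplitK (inr _)) scaleNr -scalerA.
  by rewrite -scaler_sumr sumrN -scaler_sumr scalerBr.
Qed.

Lemma relint_par_shift C p q : relint C p -> par C q ->
  exists2 t : K, 0 < t & C (p + t *: q).
Proof.
move=> [Cp [W Wp WC]] [a [b [Ha Hb ->]]].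
have [d d0 Hd] := (near_distP p W).1 Wp.
have [r r0 Hr] := dist_segment p (a - b) d0.
exists (r / 2); first by rewrite divr_gt0.
apply: WC; split; last exact: affine_hull_shift.
by apply: Hd; apply: Hr; rewrite gtr0_norm ?divr_gt0//; lra.
Qed.

End AffineHull.

(** The filter stands for a subsequence: the unit directions from [M] to [x_k] exist only at indices
    with [x_k] off [M]. *)
Lemma sphere_cluster (K : realType) n (w : nat -> 'rV[K]_n) (F : set_system nat)
    (FF : ProperFilter F) : F [set k | `|w k| = 1] ->
  exists2 w0, `|w0| = 1 & forall Q e, F Q -> 0 < e ->
    exists2 k, Q k & `|w k - w0| < e.
Proof.
move=> Fw; pose S := [set x : 'rV[K]_n | `|x| = 1].
have Sc : compact S.
  apply: bounded_closed_compact.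
    by exists 1; split; [exact: num_real|move=> y y1 x /= ->; exact: ltW].
  apply: (@preimage_closed _ _ (fun x : 'rV[K]_n => `|x| : K) [set 1]).
    by move=> x _; exact: norm_continuous.
  exact: closed_eq.
have [w0 [w01 cl]] := Sc (w @ F) (fmap_proper_filter w FF) Fw.
exists w0 => // Q e FQ e0.
have wQ : F (w @^-1` (w @` Q)) by apply: filterS FQ => k Qk; exists k.
have nw : nbhs w0 [set x : 'rV[K]_n | `|x - w0| < e].
  pose B : set 'rV[K]_n := [set x | `|x - w0| < e].
  exact: ((near_distP (w0 : 'rV[K]_n) B).2 (ex_intro2 _ _ e e0 (fun _ h => h))).
by have [_ [[k Qk <-] wk]] := cl _ _ wQ nw; exists k.
Qed.

Section Identification.
Context {K : realType} {n : nat}.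
Variables (M U V : set 'rV[K]_n) (d : nat) (phi psi : 'rV[K]_n -> 'rV[K]_n).
Variables (xs ps : 'rV[K]_n) (J : 'rV[K]_n -> \bar K).
Hypotheses (chart : slice_chart M U V d phi psi xs) (Mxs : M xs).
Hypothesis (Jproper : Defs.proper J).

Local Notation proj := (pid_mx d : 'M[K]_n).
Local Notation xi := (phi xs).
Local Notation Jphi := (jacobian phi xs).

(** Near 0 the last [n - d] coordinates of [phi] along the curve vanish identically, so their
    derivatives do. *)
Lemma tangent_chart w : tangent_space M xs w -> w *m Jphi *m proj = w *m Jphi.
Proof.
move=> [c [c0 cM [dc cw]]].
have difc : differentiable c 0 by exact/derivable1_diffP.
have difphi : differentiable phi (c 0).
  by rewrite c0; exact: ((chart_C2phi chart).1 _ (chart_Uxs chart)).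
have Dphi : 'D_(1 : K^o) (phi \o c) 0 = w *m Jphi.
  by rewrite derive_comp// cw c0 deriveEjacobian// -c0.
have dphic : derivable (phi \o c) (0 : K^o) (1 : K^o).
  exact: (diff_derivable (differentiable_comp difc difphi)).
have cU : \forall t \near (0 : K^o), U (c t).
  have cc : {for 0, continuous c} := differentiable_continuous difc.
  apply: cc; rewrite c0.
  exact: (open_nbhs_nbhs (conj (chart_openU chart) (chart_Uxs chart))).
apply/rowP => i; rewrite mul_pid_mx_coord; case: ltnP => // di.
rewrite -Dphi derive_mx// mxE.
have near0 : \forall t \near (0 : K^o), (phi \o c) t 0 i = cst (0 : K) t.
  by apply: filterS2 cM cU => t Mt Ut /=; exact: ((chart_slice chart Ut).1 Mt i
    di).
by rewrite (near_eq_derive _ near0) derive_cst.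
Qed.

Hypothesis sharp :
  tangent_space M xs = orthogonal_complement (par (subdifferential J xs)).
Hypothesis inner : subdifferential J xs `<=` inner_limit (subdifferential J) M
  xs.
Hypothesis nondegenerate : relint (subdifferential J xs) ps.

Local Notation Psi := (fun eta : 'rV[K]_n => psi (eta *m proj)).

(* If x_k stays off M, let y_k be the point of M with the same first d chart
   coordinates; a cluster point w of the directions of x_k - y_k is not tangent
   to M, so sharpness yields q in par (dJ(xs)) with <w, q> > 0.  By
   nondegeneracy and continuity, ps + t q is a limit of subgradients at y_k,
   and monotonicity of dJ between x_k and y_k gives - t <q, w> >= 0. *)
Lemma finite_identification (x p : nat -> 'rV[K]_n) :
  x @ \oo --> xs -> p @ \oo --> ps ->
  (forall k, subdifferential J (x k) (p k)) ->
  \forall k \near \oo, M (x k).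
Proof.
move=> xxs pps gp; apply: contrapT => noM.
(* Events that hold at all large indices with [x k] off [M]; failure of the claim makes this filter
   proper. *)
pose F : set_system nat := fun A => \forall k \near \oo, ~ M (x k) -> A k.
have FF : ProperFilter F.
  split; last first.
    split.
    - by apply: nearW.
    - by move=> A A'; rewrite /F => hA hA'; apply: filterS2 hA hA' => k h h'
      nM; split; [exact: h|exact: h'].
    - by move=> A A' AA'; rewrite /F; apply: filterS => k h nM; exact/AA'/h.
  rewrite /F => F0; apply: noM; apply: filterS F0 => k h; apply: contrapT => nM.
  exact: h.
have FoO Q : (\forall k \near \oo, Q k) -> F Q by rewrite /F; apply: filterS.
have [e1 e10 HU] : exists2 e : K, 0 < e & forall y, `|y - xs| < e -> U y.
  by apply/near_distP; exact: (open_nbhs_nbhs (conj (chart_openU chart)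
    (chart_Uxs chart))).
have sphi := chart_strict_phi chart; have sPsi := chart_strict_Psi chart Mxs.
pose y k := psi (phi (x k) *m proj).
have xik : (fun k => phi (x k)) @ \oo --> xi := strict_cvg sphi xxs.
have yxs : y @ \oo --> xs.
  by rewrite -[X in _ --> X](chart_Psi_xi chart Mxs); exact: (strict_cvg sPsi
    xik).
have [r r0 Hr] := chart_neighbourhood chart Mxs openT (I : setT xs).
have My : \forall k \near \oo, M (y k) /\ phi (y k) = phi (x k) *m proj.
  have /cvg_distP/(_ _ r0) := xik; apply: filterS => k /Hr[Vk _ _ Mk]; split=>
    //.
  exact: (chart_psiK chart Vk).2.
have xy : F [set k | x k - y k != 0].
  rewrite /F; apply: filterS My => k [Mk _] nM /=; rewrite subr_eq0; apply/eqP
    => e.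
  by apply: nM; rewrite e.
pose w k := `|x k - y k|^-1 *: (x k - y k).
have w1 : F [set k | `|w k| = 1].
  apply: filterS xy => k /= h; rewrite normrZ normfV normr_id mulVf//.
  by rewrite normr_eq0.
have [w0 w01 Hw0] := sphere_cluster FF w1.
(* [phi (x k)] and [phi (y k)] share their first [d] coordinates, so the derivative of [phi] sends
   the limiting direction into the last [n - d] ones. *)
have w0J : w0 *m Jphi *m proj = 0.
  apply/eqP; rewrite -normr_le0; apply/ler_addgt0Pr => e e0; rewrite add0r.
  have [c1 c10 Hc1] := mulmx_bounded proj.
  have [c2 c20 Hc2] := mulmx_bounded (Jphi *m proj).
  have e2 : 0 < e / (2 * c1) by rewrite divr_gt0// mulr_gt0.
  have e3 : 0 < e / (2 * c2) by rewrite divr_gt0// mulr_gt0.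
  have [dl dl0 Hs] := sphi _ e2.
  have near1 : \forall k \near \oo, `|x k - xs| < dl /\ `|y k - xs| < dl.
    have /cvg_distP/(_ _ dl0) := xxs; have /cvg_distP/(_ _ dl0) := yxs.
    exact: filterS2.
  have [k [[[h1 h2] [_ py]] xyk] wk] :=
    Hw0 _ _ (filterI (FoO _ (filterI near1 My)) xy) e3.
  have xy0 : 0 < `|x k - y k| by rewrite normr_gt0.
  have := Hs _ _ h1 h2; rewrite py.
  set D := x k - y k in xy0 *; set P := phi (x k) => h3.
  have pid : proj *m proj = proj by rewrite pid_mx_id// (chart_dim chart).
  have h4 : `|D *m Jphi *m proj| <= c1 * (e / (2 * c1) * `|D|).
    apply: le_trans (ler_wpM2l (ltW c10) h3).
    apply: le_trans (Hc1 _).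
    by rewrite !mulmxBl -(mulmxA P) pid subrr sub0r normrN.
  have h5 : `|w k *m Jphi *m proj| <= e / 2.
    rewrite /w -/D -!scalemxAl normrZ gtr0_norm ?invr_gt0//.
    rewrite ler_pdivrMl// (le_trans h4)// le_eqVlt; apply/orP; left; apply/eqP.
    by field; rewrite gt_eqF.
  have -> : w0 *m Jphi *m proj =
      w k *m Jphi *m proj - (w k - w0) *m (Jphi *m proj).
    by rewrite [in RHS]mulmxA !mulmxBl opprB addrC subrK.
  rewrite (le_trans (ler_normB _ _))//.
  have := Hc2 (w k - w0); have := ltW wk => h6 h7.
  have := le_trans h7 (ler_wpM2l (ltW c20) h6).
  have -> : c2 * (e / (2 * c2)) = e / 2 by field; rewrite gt_eqF.
  lra.
have w0_not_tangent : ~ tangent_space M xs w0.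
  move=> /tangent_chart; rewrite w0J => wJ.
  have : w0 = 0.
    by rewrite -[w0]mulmx1 -(chart_JphiK chart) mulmxA -wJ mul0mx.
  by move=> w00; move: w01; rewrite w00 normr0 => /eqP; rewrite eq_sym oner_eq0.
(* By sharpness [w0], not being tangent, is not orthogonal to [par]; replacing [q] by [- q] fixes
   the sign. *)
have [q parq wq] : exists2 q, par (subdifferential J xs) q & 0 < dot w0 q.
  apply: contrapT => noq; apply: w0_not_tangent; rewrite sharp => q parq.
  apply/eqP; rewrite eq_le !leNgt; apply/andP; split; apply/negP => lt.
    by apply: noq; exists q.
  apply: noq; exists (- q); last by rewrite dotNr oppr_gt0.
  case: parq => a [b [Ha Hb ->]]; exists b, a; split=> //.
  by rewrite opprB.
have [t t0 gt] := relint_par_shift nondegenerate parq.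
(* Three errors of size [dl], on [p k], [h] and [w k], cost together at most [(c - 1) dl], and
   [c dl = t s]. *)
set s := dot w0 q in wq; pose c := 1 + n%:R * (2 + t * `|q|).
have c0 : 0 < c by rewrite ltr_pwDl// mulr_ge0// addr_ge0// mulr_ge0// ltW.
have dl0 : 0 < t * s / c by rewrite divr_gt0// mulr_gt0.
set dl := t * s / c in dl0.
pose W : set 'rV[K]_n := [set h | `|h - (ps + t *: q)| < dl].
have nq : nbhs (ps + t *: q) W.
  exact: ((near_distP (ps + t *: q) W).2 (ex_intro2 _ _ dl dl0 (fun _ h => h))).
have /near_distP[r1 r10 Hr1] := inner gt nq.
have near2 : \forall k \near \oo, [/\ `|y k - xs| < r1, M (y k) & `|p k - ps| <
  dl].
  have /cvg_distP/(_ _ r10) n1 := yxs; have /cvg_distP/(_ _ dl0) n2 := pps.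
  by apply: filterS3 n1 n2 My => k h1 h2 [h3 _].
have [k [[yk Mk pk] [xyk w1k]] wk] :=
  Hw0 _ _ (filterI (FoO _ near2) (filterI xy w1)) dl0.
have [h [gh hk]] := Hr1 _ yk Mk.
have xy0 : 0 < `|x k - y k| by rewrite normr_gt0.
have := subdifferential_monotone Jproper (gp k) gh.
have -> : x k - y k = `|x k - y k| *: w k.
  by rewrite /w scalerA divff ?scale1r// gt_eqF.
rewrite dotZr pmulr_rge0//.
have -> : p k - h = (p k - ps) - (h - (ps + t *: q)) - t *: q.
  by apply/rowP => i; rewrite !mxE; ring.
rewrite dotBl dotZl [dot (_ - _ - _) _]dotBl.
have i1 := norm_dot_le (p k - ps) (w k).
have i2 := norm_dot_le (h - (ps + t *: q)) (w k).
have i3 := norm_dot_le q (w k - w0).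
rewrite w1k mulr1 in i1; rewrite w1k mulr1 in i2.
rewrite dotBr [dot q w0]dotC -/s in i3.
set A1 := dot _ _ in i1 *; set A2 := dot _ _ in i2 *; set A3 := dot q _ in i3 *.
have j1 : A1 <= n%:R * dl.
  by rewrite (le_trans (ler_norm _))// (le_trans i1)// ler_wpM2l// ltW.
have j2 : - A2 <= n%:R * dl.
  rewrite (le_trans (ler_norm _))// normrN (le_trans i2)// ler_wpM2l//; exact:
    ltW.
have j3 : s - A3 <= n%:R * (`|q| * dl).
  rewrite (le_trans (ler_norm _))// distrC (le_trans i3)// ler_wpM2l//.
  by rewrite ler_wpM2l// ltW.
have j4 := ler_wpM2l (ltW t0) j3.
have : c * dl = t * s by rewrite /dl mulrC divfK// gt_eqF.
rewrite /c; lra.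
Qed.

End Identification.

(** * Linearization of the proximal map of the smooth function [R] *)

Section SmoothResolvent.
Context {K : realType} {n : nat}.
Variables (R : 'rV[K]_n -> \bar K) (xs : 'rV[K]_n) (gamma : K).
Variable U : set 'rV[K]_n.
Hypotheses (Rproper : Defs.proper R) (Rconvex : convex_ext R) (gamma0 : 0 <
  gamma).
Hypotheses (oU : open U) (Uxs : U xs).
Hypothesis Rfin : forall y, U y -> R y \is a fin_num.
Local Notation r := (fun y => fine (R y) : K^o).
Hypothesis C2r : Ck 2 U r.

Local Notation H := (hessian r xs).

Lemma near_open (O : set 'rV[K]_n) y : open O -> O y -> \forall t \near y, O t.
Proof. by move=> oO Oy; exact: open_nbhs_nbhs. Qed.

Lemma subgradient_gradient y p :
  U y -> subdifferential R y p -> gradient r y = p.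
Proof.
move=> Uy py; apply/rowP => j; rewrite mxE.
rewrite (Fermat_subgradient (p := p)) ?dot_delta//.
  by apply: filterS (near_open oU Uy) => t; exact: (C2r.1 t).
apply: filterS (near_open oU Uy) => t Ut.
exact: subgradient_fine (Rfin Uy) (Rfin Ut) py.
Qed.

Lemma fine_has_gradient : has_gradient_near r (gradient r) xs.
Proof.
apply: filterS (near_open oU Uxs) => t /(C2r.1 t) dt; split=> // v.
exact: derive_gradient.
Qed.

Lemma fine_hessian_sym : H^T = H.
Proof. exact: (strict_hessian_sym fine_has_gradient (strict_gradient oU Uxs
  C2r)). Qed.

Lemma fine_hessian_psd p : subdifferential R xs p -> psd H.
Proof.
move=> pxs; apply: (strict_hessian_psd fine_has_gradient (strict_gradient oU
  Uxs C2r)).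
apply: filterS (near_open oU Uxs) => t Ut.
rewrite (subgradient_gradient Uxs pxs).
exact: subgradient_fine (Rfin Uxs) (Rfin Ut) pxs.
Qed.

Lemma cvg_dot (a b : nat -> 'rV[K]_n) a0 b0 :
  a @ \oo --> a0 -> b @ \oo --> b0 ->
  forall e, 0 < e -> \forall k \near \oo, `|dot (a k) (b k) - dot a0 b0| <= e.
Proof.
move=> aa bb e e0; have e2 : 0 < e / 2 by rewrite divr_gt0.
have one0 : \forall k \near \oo, 0 <= (fun=> 1 : K) k by apply: nearW.
have a_cvg : (fun k => a k - a0) @ \oo --> (0 : 'rV[K]_n).
  by rewrite -[0](subrr a0); apply: cvgB => //; exact: cvg_cst.
have b_cvg : (fun k => b k - b0) @ \oo --> (0 : 'rV[K]_n).
  by rewrite -[0](subrr b0); apply: cvgB => //; exact: cvg_cst.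
have bO : big_O b (fun=> 1).
  exists (`|b0| + 1); first by rewrite ltr_wpDl.
  have /cvg_distP/(_ _ ltr01) := bb; apply: filterS => k /ltW h.
  rewrite mulr1 -[b k](subrK b0) addrC (le_trans (ler_normD _ _))//.
  by rewrite lerD2l.
have aO : big_O (fun=> a0) (fun=> 1 : K).
  exists (1 + `|a0|); first by rewrite ltr_pwDl.
  by apply: nearW => k; rewrite mulr1 lerDr.
apply: filterS2 (small_o_dot_l one0 a_cvg bO e2) (small_o_dot_l one0 b_cvg aO
  e2).
move=> k h1 h2.
have -> : dot (a k) (b k) - dot a0 b0 = dot (a k - a0) (b k) + dot (b k - b0)
  a0.
  by rewrite !dot_lin (dotC (b k) a0) (dotC b0 a0); ring.
rewrite (le_trans (ler_normD _ _))//; lra.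
Qed.

(** [R] is continuous at [xs], so both sides of the subgradient inequality at [v k] pass to the
    limit. *)
Lemma subdifferential_closed (v p : nat -> 'rV[K]_n) ps :
  v @ \oo --> xs -> p @ \oo --> ps ->
  (forall k, subdifferential R (v k) (p k)) -> subdifferential R xs ps.
Proof.
move=> vxs pps gp y; have [fy|fy] := boolP (R y \is a fin_num); last first.
  move: fy; rewrite fin_numE Rproper.1/= negbK => /eqP ->; exact: leey.
rewrite -[R xs]fineK ?Rfin// -[R y]fineK// -EFinD lee_fin.
apply/ler_addgt0Pr => e e0; have e2 : 0 < e / 2 by rewrite divr_gt0.
have yv : (fun k => y - v k) @ \oo --> y - xs by apply: cvgB => //; exact:
  cvg_cst.
have [d d0 Hd] := (continuous_distP _ _).1
  (differentiable_continuous (C2r.1 xs Uxs)) _ e2.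
have /cvg_distP/(_ _ d0) nv := vxs.
have [k [/Hd/ler_normlP[h1 h2] /ler_normlP[h3 h4]]] :=
  filter_ex (filterI nv (cvg_dot pps yv e2)).
have Rv := subgradient_fin_num Rproper (gp k).
have := subgradient_fine Rv fy (gp k); move: h1 h2 h3 h4.
rewrite /=; lra.
Qed.

(** The gradient at [v k] is [gamma^-1 (s k - v k)] and its increment is [dv H] to first order, so
    [dv (1 + gamma H) = ds] up to a small error. *)
Lemma resolvent_increment (v s : nat -> 'rV[K]_n) (b : nat -> K) :
  v @ \oo --> xs ->
  (forall k, subdifferential R (v k) (gamma^-1 *: (s k - v k))) ->
  psd H -> big_O (fun k => v k.+1 - v k) b ->
  small_o (fun k => v k.+1 - v k - (s k.+1 - s k) *m resolvent_mx gamma H) b.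
Proof.
move=> vxs gv Hpsd dv.
have n1 := strict_increment (strict_gradient oU Uxs C2r) vxs dv.
have Uv : \forall k \near \oo, U (v k).
  have /near_distP[e e0 He] := near_open oU Uxs.
  by have /cvg_distP/(_ _ e0) := vxs; apply: filterS => k; exact: He.
have Uv' := near_shift1r Uv.
have n2 := small_o_mulmx (- gamma *: resolvent_mx gamma H) n1.
apply: small_o_eq n2; apply: filterS2 Uv Uv' => k Uk Uk'.
rewrite (subgradient_gradient Uk (gv k)) (subgradient_gradient Uk' (gv k.+1)).
set L := resolvent_mx _ _; set dvk := v k.+1 - v k; set dsk := s k.+1 - s k.
have uL := resolvent_unit gamma0 Hpsd.
have -> : gamma^-1 *: (s k.+1 - v k.+1) - gamma^-1 *: (s k - v k) - dvk *m H =
   - gamma^-1 *: (dvk *m (1%:M + gamma *: H) - dsk).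
  rewrite mulmxDr mulmx1 -scalemxAr.
  have -> : s k.+1 - v k.+1 = s k + dsk - (v k + dvk).
    by rewrite /dsk /dvk ![_ + (_ - _)]addrC !subrK.
  clearbody dsk dvk; apply/rowP => i; rewrite !mxE; field.
  by rewrite gt_eqF.
rewrite -scalemxAl -scalemxAr scalerA mulrNN mulVf ?gt_eqF// scale1r.
by rewrite mulmxBl mulmxK.
Qed.

End SmoothResolvent.

(** * Limit point, linearized recursion and angles of the Douglas-Rachford sequence *)

Theorem theorem3p14 (K : realType) (n : nat) (R J : 'rV[K]_n -> \bar K)
  (gamma : K) (u z x : nat -> 'rV[K]_n) (zs xs : 'rV[K]_n)
  (MJ : set 'rV[K]_n)
  (hR : Gamma0 R) (hJ : Gamma0 J)
  (hri : relint (dom R) `&` relint (dom J) !=set0)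
  (hargmin : Argmin (R \+ J)%E !=set0)
  (hgamma : 0 < gamma)
  (hDR : Douglas_Rachford gamma R J u z x)
  (hz : z @ \oo --> zs)
  (hxs : prox gamma J zs xs)
  (hRC2 : locally_C2 R xs)
  (hJps : partly_smooth J MJ xs)
  (hnd : [set gamma *: g | g in relint (subdifferential J xs)] (zs - xs)) :
  [/\ prox gamma R (2 *: xs - zs) xs,
      x @ \oo --> xs, u @ \oo --> xs & Argmin (R \+ J)%E xs] /\
  exists M : 'M[K]_n,
    (fun k => z k.+1 - z k - (z k - z k.-1) *m M^T)
      =o_\oo (fun k => (enorm (z k - z k.-1) : K^o)) /\
    let H := hessian (fun y => fine (R y)) xs in
    (gamma%:E < ((opnorm H)%:E)^-1)%E ->
      real_spectrum M /\
      (forall rho : K,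
         second_largest_eigenvalue M < rho < 1 ->
         asymp (fun k => enorm (x k.+1 - x k)) (fun k => rho ^+ k) ->
         type_I z).
Proof.
have [Rproper Rconvex _] := hR; have [Jproper Jconvex _] := hJ.
have [px0 DR] := hDR.
have px k : prox gamma J (z k) (x k) by case: k => [|k] //; case: (DR k).
have pu k : prox gamma R (2 *: x k - z k) (u k.+1) by case: (DR k).
have zS k : z k.+1 = z k + u k.+1 - x k by case: (DR k).
have [Ur [oUr Urxs Rfin C2r]] := hRC2.
have gJ k := prox_subgradient Jproper Jconvex hgamma (px k).
have gR k := prox_subgradient Rproper Rconvex hgamma (pu k).
have gJs := prox_subgradient Jproper Jconvex hgamma hxs.
have n1_gt0 : 0 < n%:R + 1 :> K by rewrite ltr_wpDl.
have enorm_le (v : 'rV[K]_n) : enorm v <= (n%:R + 1) * `|v|.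
  by rewrite (le_trans (enorm_le_norm _))// ler_wpM2r// lerDl.
have x_cvg : x @ \oo --> xs.
  apply/cvg_distP => e e0.
  have /cvg_distP/(_ _ (divr_gt0 e0 n1_gt0)) := hz; apply: filterS => k h.
  rewrite (le_lt_trans (norm_le_enorm _))//.
  rewrite (le_lt_trans (prox_nonexpansive Jproper Jconvex hgamma (px k) hxs))//.
  by rewrite (le_lt_trans (enorm_le _))// mulrC -ltr_pdivlMr.
(* [u 0] is arbitrary, so convergence is proved for the shifted sequence, which the update of [z]
   expresses by [z] and [x]. *)
have uS_cvg : (fun k => u k.+1) @ \oo --> xs.
  have -> : (fun k => u k.+1) = (fun k => z k.+1 - z k + x k).
    by apply/funext => k; rewrite zS addrAC subrK addrAC subrr add0r.
  rewrite -[xs]add0r -(subrr zs); apply: cvgD => //; apply: cvgB => //.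
  exact: cvg_shift1.
have s_cvg : (fun k => 2 *: x k - z k) @ \oo --> 2 *: xs - zs.
  by apply: cvgB => //; apply: cvgZl_tmp.
(* The limit of the subgradients of [R] at [u k.+1]; it is opposite to the subgradient of [J] at
   [xs], which gives optimality. *)
have gRs : subdifferential R xs (gamma^-1 *: (2 *: xs - zs - xs)).
  apply: (subdifferential_closed Rproper Urxs Rfin C2r uS_cvg _ gR).
  by apply: cvgZl_tmp; exact: cvgB.
split.
  split=> //.
  - exact: subgradient_prox.
  - by rewrite -(cvg_shiftS u).
  - apply: (subdifferential_sum_Argmin Rproper Jproper gRs).
    have -> // : - (gamma^-1 *: (2 *: xs - zs - xs)) = gamma^-1 *: (zs - xs).
    by rewrite -scalerN; congr (_ *: _); apply/rowP => i; rewrite !mxE; ring.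
have [[Mxs [d [U [V [phi [psi chart]]]]]] [Ug [g [oUg Ugxs C2g Jg]]] sharp
  [inner _]] := hJps.
have identified : \forall k \near \oo, MJ (x k).
  have [ps nd psE] := hnd.
  have {}psE : ps = gamma^-1 *: (zs - xs).
    by rewrite -psE scalerA mulVf ?scale1r// gt_eqF.
  rewrite psE in nd.
  apply: (finite_identification chart Mxs Jproper sharp inner nd x_cvg _ gJ).
  by apply: cvgZl_tmp; exact: cvgB.
pose b k := `|z k.+1 - z k|.
have dz : big_O (fun k => z k.+1 - z k) b.
  by exists 1 => //; apply: nearW => k; rewrite mul1r.
have dx_le k : enorm (x k.+1 - x k) <= (n%:R + 1) * b k.
  apply: le_trans (prox_nonexpansive Jproper Jconvex hgamma (px k.+1) (px k)) _.
  exact: enorm_le.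
have dx : big_O (fun k => x k.+1 - x k) b.
  exists (n%:R + 1) => //; apply: nearW => k.
  exact: le_trans (norm_le_enorm _) (dx_le k).
have [N [Nsym Nfirm xN]] :=
  manifold_increment chart Mxs hgamma oUg Ugxs C2g Jg gJs x_cvg hz identified
    gJ dx.
set H := hessian _ _.
have Hsym : H^T = H := fine_hessian_sym oUr Urxs C2r.
have Hpsd : psd H := fine_hessian_psd oUr Urxs Rfin C2r gRs.
pose s k := 2 *: x k - z k.
have sE k : s k.+1 - s k = 2 *: (x k.+1 - x k) - (z k.+1 - z k).
  by apply/rowP => i; rewrite !mxE; ring.
have ds : big_O (fun k => s k.+1 - s k) b.
  have [c c0 hc] := big_OD (big_OD dx dx) (big_ON dz); exists c => //.
  by apply: filterS hc => k; rewrite sE scaler_nat mulr2n.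
have du : big_O (fun k => u k.+2 - u k.+1) b.
  have [c c0 hc] := ds; exists ((n%:R + 1) * c); first exact: mulr_gt0.
  apply: filterS hc => k h; rewrite (le_trans (norm_le_enorm _))//.
  apply: le_trans (prox_nonexpansive Rproper Rconvex hgamma (pu k.+1) (pu k)) _.
  by rewrite (le_trans (enorm_le _))// -mulrA ler_wpM2l// ltW.
have uL := resolvent_increment hgamma oUr Urxs Rfin C2r uS_cvg gR Hpsd du.
pose M := DR_mx gamma H N.
(* One index later than in the conclusion, since [u k.+1], unlike [u k], is a proximal point for
   every [k]. *)
have zM : small_o (fun k => z k.+2 - z k.+1 - (z k.+1 - z k) *m M^T) b.
  have sN := small_o_mulmx (2 *: resolvent_mx gamma H) xN.
  apply: small_o_eq (small_oB (small_oD uL sN) xN); apply: nearW => k.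
  rewrite -![2 *: x _ - z _]/(s _) sE trmxK (zS k.+1).
  have -> : z k.+1 + u k.+2 - x k.+1 - z k.+1 =
      (z k.+1 - z k) + (u k.+2 - u k.+1) - (x k.+1 - x k).
    rewrite [in RHS](zS k); apply/rowP => i; rewrite !mxE; ring.
  set D := z k.+1 - z k; set Dx := x k.+1 - x k; set Du := u k.+2 - u k.+1.
  set L := resolvent_mx gamma H; clearbody D Dx Du L.
  have -> : D *m (1%:M + (2 *: N - 1%:M) *m L - N) =
      D + (2 *: (D *m N *m L) - D *m L) - D *m N.
    rewrite mulmxBr mulmxDr mulmx1 mulmxBl mul1mx mulmxBr -scalemxAl -scalemxAr.
    by rewrite mulmxA.
  have -> : (2 *: Dx - D) *m L = 2 *: (Dx *m L) - D *m L.
    by rewrite mulmxBl scalemxAl.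
  have -> : (Dx - D *m N) *m (2 *: L) = 2 *: (Dx *m L) - 2 *: (D *m N *m L).
    by rewrite -scalemxAr mulmxBl scalerBr.
  move: (D *m N *m L) (D *m N) (D *m L) (Dx *m L) => a1 a2 a3 a4.
  by apply/rowP => i; rewrite !mxE; ring.
exists M; split.
  (* At [k = 0] the truncated predecessor makes the reference increment 0; the shift discards this
     index. *)
  apply/eqoP => e e0; apply: near_shift1; apply: filterS (zM e e0) => k /= h.
  rewrite (le_trans h)// ler_wpM2l ?(ltW e0)//.
  by rewrite [`|enorm _|]ger0_norm ?enorm_ge0// norm_le_enorm.
move=> /= gH; have {}gH : gamma * opnorm H < 1.
  exact: lt_inve_mul_lt1 (opnorm_ge0 H) gH.
have Psym := reflection_sym gamma Hsym.
have Ppd := reflection_pd hgamma Hsym Hpsd gH.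
have MPsym := DR_mx_sym gamma Hsym Nsym.
have MPpsd := DR_mx_psd hgamma Hsym Hpsd Nsym Nfirm gH.
split; first exact: (real_spectrum_symmetric Psym Ppd MPsym).
move=> rho /andP[srho rho1] [c [C [/andP[c0 _] xrho]]].
have rho0 : 0 < rho.
  exact: le_lt_trans (second_largest_eigenvalue_ge0 Ppd MPpsd) srho.
apply: (DR_type_I hgamma Hsym Hpsd Nsym Nfirm gH (c := c / (n%:R + 1)) _ _ _
  srho).
- by move=> e e0; apply: near_shift1; exact: zM.
- exact: divr_gt0.
(* The proximal map of [J] is nonexpansive, so a lower bound on [x k.+1 - x k] is one on
   [z k.+1 - z k], up to the factor [n + 1] between the norms. The shift of index replaces [rho^k]
   by the smaller [rho^(k + 1)]. *)
- apply: near_shift1; apply: filterS xrho => k /andP[h _].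
  rewrite mulrAC ler_pdivrMr// mulrC.
  apply: le_trans (le_trans _ h) _; last by rewrite mulrC; exact: dx_le.
  by rewrite mulrC ler_pM2l// exprS ler_piMl ?exprn_ge0 ?ltW.
Qed.
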